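(* Let $S$ be a positive semifield. The category of Eilenberg–Moore algebras of the monad $\mathcal C$ (defined below) is isomorphic to the category of $(\Sigma,E)$-algebras; that is, $\mathcal C$ is presented by the algebraic theory $(\Sigma,E)$.
   Context: $S$ positive: $a+b=0\Rightarrow a=b=0$; semifield: nonzero elements are invertible. $\mathcal SX$: finitely supported $\phi\colon X\to S$; $\mathcal S(f)(\phi)(y)=\sum_{x\in f^{-1}\{y\}}\phi(x)$; $\mu^{\mathcal S}_X(\Psi)(x)=\sum_{\phi\in\mathrm{supp}\Psi}\Psi(\phi)\phi(x)$. A subset $\mathcal A\subseteq\mathcal SX$ is convex if it contains $\mu^{\mathcal S}_X(\Psi)$ for every $\Psi\in\mathcal S\mathcal SX$ with $\mathrm{supp}\Psi\subseteq\mathcal A$ and $\sum\Psi(\phi)=1$. The monad $\mathcal C$ on Set: $\mathcal CX$ is the set of convex subsets of $\mathcal SX$; $\mathcal C(f)(\mathcal A)=\{\mathcal S(f)(\Phi)\mid\Phi\in\mathcal A\}$; $\eta_X(x)=\{\Delta_x\}$; $\mu_X(\mathscr A)=\bigcup_{\Omega\in\mathscr A}\{\mu^{\mathcal S}_X(\Psi)\mid\Psi\in c(\Omega)\}$ where $c(\Omega)$ is the set of $\chi_u(\phi)=\sum_{\mathcal A\in\mathrm{supp}\Omega,\,u(\mathcal A)=\phi}\Omega(\mathcal A)$ over $u\colon\mathrm{supp}\Omega\to\mathcal SX$ with $u(\mathcal A)\in\mathcal A$. The (infinitary) theory $(\Sigma,E)$: operations $\bigsqcup_I$ of arity $I$ for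 every set $I$, binary $+$, constant $0$, unary $\lambda\cdot$ for each $\lambda\in S$; equations: complete semilattice axioms ($\bigsqcup_{i\in\{0\}}x_i=x_0$; $\bigsqcup_{j\in J}x_j=\bigsqcup_{i\in I}x_{f(i)}$ for surjective $f\colon I\to J$; $\bigsqcup_{i\in I}x_i=\bigsqcup_{j\in J}\bigsqcup_{i\in f^{-1}\{j\}}x_i$ for any $f\colon I\to J$), left $S$-semimodule axioms ($+$ associative, commutative with unit $0$; $\lambda\cdot0=0$; $0_S\cdot x=0$; $1_S\cdot x=x$; $(\lambda\mu)\cdot x=\lambda\cdot(\mu\cdot x)$; $\lambda\cdot(x+y)=\lambda\cdot x+\lambda\cdot y$; $(\lambda+\mu)\cdot x=\lambda\cdot x+\mu\cdot x$), and distributivity: $\lambda\cdot\bigsqcup_{i\in I}x_i=\bigsqcup_{i\in I}\lambda\cdot x_i$ for $\lambda\neq0$, and $\bigsqcup_{i\in I}x_i+\bigsqcup_{j\in J}y_j=\bigsqcup_{(i,j)\in I\times J}(x_i+y_j)$. Morphisms of $(\Sigma,E)$-algebras preserve all operations. *)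

(* Defs.v *)
From HB Require Import structures.
From mathcomp Require Import all_boot all_algebra.
From mathcomp Require Import finmap.
From mathcomp Require Import boolp classical_sets functions cardinality fsbigop.

Set Implicit Arguments.
Unset Strict Implicit.
Unset Printing Implicit Defensive.

Import GRing.Theory.
Local Open Scope classical_set_scope.
Local Open Scope ring_scope.

Record category := Category {
  obj :> Type;
  hom : obj -> obj -> Type;
  idm : forall X, hom X X;
  comp : forall X Y Z, hom Y Z -> hom X Y -> hom X Z;
  comp1m : forall X Y (f : hom X Y), comp (idm Y) f = f;
  compm1 : forall X Y (f : hom X Y), comp f (idm X) = f;
  compA : forall X Y Z W (h : hom Z W) (g : hom Y Z) (f : hom X Y),
    comp h (comp g f) = comp (comp h g) f }.

Arguments hom {c} X Y.
Arguments idm {c} X.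
Arguments comp {c X Y Z} g f.

Record functor (A B : category) := Functor {
  fobj :> A -> B;
  fmap : forall X Y : A, hom X Y -> hom (fobj X) (fobj Y);
  fmap1 : forall X, fmap (idm X) = idm (fobj X);
  fmapM : forall X Y Z (g : hom Y Z) (f : hom X Y),
    fmap (comp g f) = comp (fmap g) (fmap f) }.

Arguments fmap {A B} F {X Y} f : rename.

Definition functor_id (A : category) : functor A A :=
  @Functor A A id (fun _ _ => id) (fun=> erefl) (fun _ _ _ _ _ => erefl).

Lemma functor_comp1 (A B C : category) (G : functor B C) (F : functor A B)
    (X : A) : fmap G (fmap F (idm X)) = idm (G (F X)).
Proof. by rewrite !fmap1. Qed.

Lemma functor_compM (A B C : category) (G : functor B C) (F : functor A B)
    (X Y Z : A) (g : hom Y Z) (f : hom X Y) :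
  fmap G (fmap F (comp g f)) = comp (fmap G (fmap F g)) (fmap G (fmap F f)).
Proof. by rewrite !fmapM. Qed.

Definition functor_comp (A B C : category) (G : functor B C) (F : functor A B) :
    functor A C :=
  @Functor A C (fun X => G (F X)) (fun _ _ f => fmap G (fmap F f))
    (functor_comp1 G F) (functor_compM G F).

Definition inverse_functors (A B : category)
    (F : functor A B) (G : functor B A) : Prop :=
  functor_comp G F = functor_id A /\ functor_comp F G = functor_id B.

(* Equality of functors is Leibniz equality, so this is isomorphism (not just
   equivalence) of categories; it is moreover required to commute with the
   given functors to [B]. *)
Definition isomorphic_over (A A' B : category)
    (U : functor A B) (U' : functor A' B) : Prop :=
  exists (F : functor A A') (G : functor A' A),
    inverse_functors F G /\ functor_comp U' F = U.

Record monad (B : category) := Monad {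
  mfun :> functor B B;
  munit : forall X : B, hom X (mfun X);
  mmult : forall X : B, hom (mfun (mfun X)) (mfun X);
  munit_nat : forall (X Y : B) (f : hom X Y),
    comp (munit Y) f = comp (fmap mfun f) (munit X);
  mmult_nat : forall (X Y : B) (f : hom X Y),
    comp (mmult Y) (fmap mfun (fmap mfun f)) = comp (fmap mfun f) (mmult X);
  mmult_unitl : forall X : B, comp (mmult X) (munit (mfun X)) = idm (mfun X);
  mmult_unitr : forall X : B,
    comp (mmult X) (fmap mfun (munit X)) = idm (mfun X);
  mmultA : forall X : B,
    comp (mmult X) (mmult (mfun X)) = comp (mmult X) (fmap mfun (mmult X)) }.

Record EM_obj (B : category) (M : monad B) := EMObj {
  em_obj :> B;
  em_str : hom (M em_obj) em_obj;
  em_unit : comp em_str (munit M em_obj) = idm em_obj;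
  em_mult : comp em_str (mmult M em_obj) = comp em_str (fmap M em_str) }.

Record EM_hom (B : category) (M : monad B) (X Y : EM_obj M) := EMHom {
  em_hom :> hom (em_obj X) (em_obj Y);
  em_homP : comp em_hom (em_str X) = comp (em_str Y) (fmap M em_hom) }.

Lemma EM_hom_eq (B : category) (M : monad B) (X Y : EM_obj M)
  (f g : EM_hom X Y) : em_hom f = em_hom g -> f = g.
Proof.
case: f g => f fP [g gP] /= fg; rewrite -{g}fg in gP *.
by rewrite (Prop_irrelevance fP gP).
Qed.

Lemma EM_id_subproof (B : category) (M : monad B) (X : EM_obj M) :
  comp (idm X) (em_str X) = comp (em_str X) (fmap M (idm X)).
Proof. by rewrite fmap1 comp1m compm1. Qed.

Lemma EM_comp_subproof (B : category) (M : monad B) (X Y Z : EM_obj M)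
    (g : EM_hom Y Z) (f : EM_hom X Y) :
  comp (comp g f) (em_str X) = comp (em_str Z) (fmap M (comp g f)).
Proof. by rewrite fmapM -compA em_homP compA em_homP compA. Qed.

Definition EM (B : category) (M : monad B) : category.
Proof.
refine (@Category (EM_obj M) (@EM_hom B M)
  (fun X => EMHom (EM_id_subproof X))
  (fun X Y Z g f => EMHom (EM_comp_subproof g f)) _ _ _).
- by move=> X Y f; apply: EM_hom_eq; rewrite /= comp1m.
- by move=> X Y f; apply: EM_hom_eq; rewrite /= compm1.
- by move=> X Y Z W h g f; apply: EM_hom_eq; rewrite /= compA.
Defined.

Definition EM_forget (B : category) (M : monad B) : functor (EM M) B :=
  @Functor (EM M) B (@em_obj B M) (fun X Y => @em_hom B M X Y)
    (fun=> erefl) (fun _ _ _ _ _ => erefl).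

(* One fixed universe: it contains both the carriers of algebras and the
   arities of the operations. *)
Definition Sets := Type.

Definition SetCat : category :=
  @Category Sets (fun X Y => X -> Y) (fun _ => id) (fun _ _ _ g f x => g (f x))
    (fun _ _ _ => erefl) (fun _ _ _ => erefl) (fun _ _ _ _ _ _ _ => erefl).

Definition positive_semiring (S : pzSemiRingType) : Prop :=
  forall a b : S, a + b = 0 -> a = 0 /\ b = 0.

Definition semifield (S : pzSemiRingType) : Prop :=
  forall a : S, a <> 0 -> exists b : S, a * b = 1 /\ b * a = 1.

(* [{classic X}] is [X] with a classical choiceType structure. *)
Definition fsum (M : nmodType) (X : Sets) (D : set X) (F : X -> M) : M :=
  \sum_(x \in (D : set {classic X})) F x.

Record fsupp (S : pzSemiRingType) (X : Sets) : Sets := Fsupp {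
  fsval :> X -> S;
  fsval_fin : finite_set [set x | fsval x != 0] }.

Definition supp (S : pzSemiRingType) (X : Sets) (phi : fsupp S X) : set X :=
  [set x | phi x != 0].

Lemma fsupp_eq (S : pzSemiRingType) (X : Sets) (phi psi : fsupp S X) :
  phi =1 psi -> phi = psi.
Proof.
case: phi psi => f fP [g gP] /= /funext fg; rewrite -{g}fg in gP *.
by rewrite (Prop_irrelevance fP gP).
Qed.

Lemma fsum_neq0 (M : nmodType) (X : Sets) (D : set X) (F : X -> M) :
  fsum D F != 0 -> exists2 x, D x & F x != 0.
Proof.
rewrite /fsum => H; apply: contrapT => /forall2NP H'.
by case/eqP: H; apply: fsbig1 => x Dx; case: (H' x) => // /negP; rewrite negbK => /eqP.
Qed.

Lemma fsmap_subproof (S : pzSemiRingType) (X Y : Sets) (f : X -> Y)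
    (phi : fsupp S X) :
  finite_set [set y | fsum (f @^-1` [set y]) phi != 0].
Proof.
apply: (@sub_finite_set _ _ (f @` supp phi)); last exact/finite_image/fsval_fin.
by move=> y /fsum_neq0[x /= <- xN0]; exists x.
Qed.

Definition fsmap (S : pzSemiRingType) (X Y : Sets) (f : X -> Y)
    (phi : fsupp S X) : fsupp S Y :=
  Fsupp (fsmap_subproof f phi).

Lemma dirac_subproof (S : pzSemiRingType) (X : Sets) (x : X) :
  finite_set [set y | (if `[< x = y >] then 1 else 0 : S) != 0].
Proof.
apply: (@sub_finite_set _ _ [set x]); last exact: finite_set1.
by move=> y /=; case: asboolP => [->|_] //; rewrite eqxx.
Qed.

Definition dirac (S : pzSemiRingType) (X : Sets) (x : X) : fsupp S X :=
  Fsupp (dirac_subproof S x).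

Lemma fsmu_subproof (S : pzSemiRingType) (X : Sets)
    (Psi : fsupp S (fsupp S X)) :
  finite_set [set x | fsum (supp Psi) (fun phi => Psi phi * phi x) != 0].
Proof.
apply: (@sub_finite_set _ _ (\bigcup_(phi in supp Psi) supp phi)).
  move=> x /fsum_neq0[phi suppPsi /=].
  have [phix0|phixN0 _] := eqVneq (phi x) 0; first by rewrite phix0 mulr0 eqxx.
  by exists phi.
by apply: bigcup_finite => [|phi _]; exact: fsval_fin.
Qed.

Definition fsmu (S : pzSemiRingType) (X : Sets)
    (Psi : fsupp S (fsupp S X)) : fsupp S X :=
  Fsupp (fsmu_subproof Psi).

Definition convex (S : pzSemiRingType) (X : Sets) (A : set (fsupp S X)) : Prop :=
  forall Psi : fsupp S (fsupp S X),
    supp Psi `<=` A -> fsum (supp Psi) Psi = 1 -> A (fsmu Psi).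

Record cset (S : pzSemiRingType) (X : Sets) : Sets := CSet {
  cset_set :> set (fsupp S X);
  cset_convex : convex cset_set }.

Lemma cset_eq (S : pzSemiRingType) (X : Sets) (A B : cset S X) :
  (forall phi, cset_set A phi <-> cset_set B phi) -> A = B.
Proof.
case: A B => A Ac [B Bc] /= AB.
have {}AB : A = B by apply/seteqP; split=> phi /AB.
by rewrite -{B}AB in Bc *; rewrite (Prop_irrelevance Ac Bc).
Qed.

Lemma chi_subproof (S : pzSemiRingType) (X : Sets) (Omega : fsupp S (cset S X))
    (u : cset S X -> fsupp S X) :
  finite_set
    [set phi | fsum [set A | supp Omega A /\ u A = phi] Omega != 0].
Proof.
apply: (@sub_finite_set _ _ (u @` supp Omega)); last exact/finite_image/fsval_fin.
by move=> phi /fsum_neq0[A [OA <-] _]; exists A.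
Qed.

(* [u] is a total function here, but only its restriction to [supp Omega]
   matters, both in [chi] and in [choices]; since [fsupp S X] is inhabited,
   every function on [supp Omega] extends to a total one. *)
Definition chi (S : pzSemiRingType) (X : Sets) (Omega : fsupp S (cset S X))
    (u : cset S X -> fsupp S X) : fsupp S (fsupp S X) :=
  Fsupp (chi_subproof Omega u).

Definition choices (S : pzSemiRingType) (X : Sets)
    (Omega : fsupp S (cset S X)) : set (fsupp S (fsupp S X)) :=
  [set chi Omega u | u in
    [set u : cset S X -> fsupp S X |
      forall A : cset S X, supp Omega A -> (A : set (fsupp S X)) (u A)]].

Definition cmu_set (S : pzSemiRingType) (X : Sets) (AA : cset S (cset S X)) :
    set (fsupp S X) :=
  \bigcup_(Omega in AA) [set fsmu Psi | Psi in choices Omega].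

Definition suppseq (S : pzSemiRingType) (X : Sets) (phi : fsupp S X) :
    seq {classic X} := fset_set (supp phi : set {classic X}).

Lemma mem_suppseq (S : pzSemiRingType) (X : Sets) (phi : fsupp S X)
  (x : {classic X}) : (x \in suppseq phi) = (phi x != 0).
Proof.
rewrite /suppseq in_fset_set; last exact: fsval_fin.
by apply/idP/idP; rewrite inE.
Qed.

Lemma fsumE (M : nmodType) (X : Sets) (D : set X) (F : X -> M)
    (r : seq {classic X}) :
  uniq r -> (forall x, D x -> F x != 0 -> (x : {classic X}) \in r) ->
  fsum D F = \sum_(x <- r | `[< D x >]) F x.
Proof.
move=> ur rP; rewrite (bigfs _ ur); first by apply: eq_fsbigl; apply/seteqP; split=> x /asboolP.
move=> x /asboolP Dx xr; apply/eqP; apply: contraNT xr => Fx; exact: rP.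
Qed.

Definition integ (S : pzSemiRingType) (X : Sets) (phi : fsupp S X)
  (g : X -> S) : S := \sum_(x <- suppseq phi) phi x * g x.

Lemma fsum_integ (S : pzSemiRingType) (X : Sets) (phi : fsupp S X)
    (D : set X) (g : X -> S) :
  fsum D (fun x => phi x * g x) =
  integ phi (fun x => if `[< D x >] then g x else 0).
Proof.
rewrite (@fsumE _ _ _ _ (suppseq phi)) ?fset_uniq //.
  by rewrite big_mkcond; apply: eq_bigr => x _; case: ifP; rewrite ?mulr0.
move=> x _; rewrite mem_suppseq; apply: contra_neq => ->; exact: mul0r.
Qed.

Lemma fsum_integ1 (S : pzSemiRingType) (X : Sets) (phi : fsupp S X)
    (D : set X) :
  fsum D phi = integ phi (fun x => if `[< D x >] then 1 else 0).
Proof.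
by rewrite -fsum_integ; congr fsum; apply/funext => x; rewrite mulr1.
Qed.

Lemma integ_supp (S : pzSemiRingType) (X : Sets) (phi : fsupp S X)
    (g h : X -> S) :
  (forall x, phi x != 0 -> g x = h x) -> integ phi g = integ phi h.
Proof.
by move=> gh; apply: eq_big_seq => x; rewrite mem_suppseq => /gh ->.
Qed.

Lemma fsum_supp (S : pzSemiRingType) (X : Sets) (phi : fsupp S X) :
  fsum (supp phi) phi = integ phi (fun=> 1).
Proof.
by rewrite fsum_integ1; apply: integ_supp => x px; rewrite asboolT.
Qed.

Lemma big_pick (M : nmodType) (X : eqType) (r : seq X) (x : X) (F : X -> M) :
  uniq r -> (x \notin r -> F x = 0) -> \sum_(y <- r | x == y) F y = F x.
Proof.
move=> ur xr; rewrite -big_filter.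
have -> : [seq y <- r | x == y] = if x \in r then [:: x] else [::].
  elim: r ur {xr} => //= y r IH /andP[yr ur]; rewrite inE IH //.
  by case: eqP => [->|_] //=; rewrite (negbTE yr).
by case: ifP xr => [_ _|_ /(_ isT) ->]; rewrite ?big_seq1 ?big_nil.
Qed.

Lemma integ_val (S : pzSemiRingType) (X : Sets) (phi : fsupp S X) (x : X) :
  integ phi (fun y => if `[< x = y >] then 1 else 0) = phi x.
Proof.
rewrite -fsum_integ1 (@fsumE _ _ _ _ (suppseq phi)) ?fset_uniq //; last first.
  by move=> y _; rewrite mem_suppseq.
rewrite -[RHS](@big_pick S {classic X} (suppseq phi) x phi); last first.
- by rewrite mem_suppseq negbK => /eqP.
- exact: fset_uniq.
- by [].
Qed.

Lemma integ_eq (S : pzSemiRingType) (X : Sets) (phi psi : fsupp S X) :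
  (forall g, integ phi g = integ psi g) -> phi = psi.
Proof. by move=> E; apply: fsupp_eq => x; rewrite -!integ_val E. Qed.

Lemma push_subproof (S : pzSemiRingType) (I : Type) (X : Sets) (r : seq I)
    (w : I -> S) (k : I -> X) :
  finite_set [set x | \sum_(i <- r | `[< k i = x >]) w i != 0].
Proof.
pose s : seq {classic X} := map k r.
apply: (@sub_finite_set _ _ [set` s]); last exact: finite_seq.
move=> x /=; apply: contraNT => xs; rewrite {}/s in xs.
elim: r xs => [|i r IH]; first by rewrite big_nil.
rewrite /= inE negb_or big_cons => /andP[/eqP xk xs].
by rewrite asboolF 1?IH // => kx; apply: xk.
Qed.

(* Push-forward along [k] of the finite family of weights [w i], [i] in [r]. *)
Definition push (S : pzSemiRingType) (I : Type) (X : Sets) (r : seq I)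
    (w : I -> S) (k : I -> X) : fsupp S X :=
  Fsupp (push_subproof r w k).

Lemma integ_push (S : pzSemiRingType) (I : eqType) (X : Sets) (r : seq I)
    (w : I -> S) (k : I -> X) (g : X -> S) :
  integ (push r w k) g = \sum_(i <- r) w i * g (k i).
Proof.
pose kc : I -> {classic X} := k.
pose s : seq {classic X} := undup (map kc r).
have us : uniq s by exact: undup_uniq.
have -> : integ (push r w k) g = fsum setT (fun x => push r w k x * g x).
  by rewrite fsum_integ; apply: integ_supp => x _; rewrite asboolT.
rewrite (fsumE us).
  rewrite (eq_bigl xpredT) => [|x]; last exact: asboolT.
  under eq_bigr => x _ do rewrite /= mulr_suml.
  rewrite (exchange_big_dep xpredT) //=; apply: eq_big_seq => i ir.
  rewrite -[RHS](@big_pick _ {classic X} s (k i) (fun x => w i * g x)) //.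
  by rewrite mem_undup (map_f kc).
move=> x _; apply: contraNT => /= xs.
rewrite big_seq_cond big_pred0 ?mul0r // => i; apply/negbTE/negP => /andP[ir /asboolP kx].
by move: xs; rewrite mem_undup -kx (map_f kc).
Qed.

Lemma push_neq0 (S : pzSemiRingType) (I : Type) (X : Sets) (r : seq I)
    (w : I -> S) (k : I -> X) (x : X) :
  push r w k x != 0 -> exists2 i, k i = x & w i != 0.
Proof.
move=> /= H; apply: contrapT => /forall2NP H'.
case/eqP: H; apply: big1 => i /asboolP kx.
by case: (H' i) => // /negP; rewrite negbK => /eqP.
Qed.

Lemma sum_neq0 (S : pzSemiRingType) (I : eqType) (r : seq I) (P : pred I)
    (w : I -> S) (i : I) : positive_semiring S ->
  i \in r -> P i -> w i != 0 -> \sum_(j <- r | P j) w j != 0.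
Proof.
move=> Spos + Pi wi; elim: r => // j r IH; rewrite inE big_cons => ir.
apply/negP; case: ifP => Pj /eqP.
  case/Spos => wj /eqP; apply/negP; case/orP: ir => [/eqP ij|/IH //].
  by rewrite -ij in wj; rewrite wj eqxx in wi.
case/orP: ir => [/eqP ij|/IH /eqP //].
by rewrite -ij Pi in Pj.
Qed.

Lemma integ_fsmap (S : pzSemiRingType) (X Y : Sets) (f : X -> Y)
  (phi : fsupp S X) (g : Y -> S) :
  integ (fsmap f phi) g = integ phi (fun x => g (f x)).
Proof.
have -> : fsmap f phi = push (suppseq phi) phi (f : {classic X} -> Y).
  apply: fsupp_eq => y /=; rewrite (@fsumE _ _ _ _ (suppseq phi)) ?fset_uniq //.
  by move=> x _; rewrite mem_suppseq.
by rewrite (integ_push _ _ (f : {classic X} -> Y)).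
Qed.

Lemma fsmap_neq0 (S : pzSemiRingType) (X Y : Sets) (f : X -> Y)
    (phi : fsupp S X) (y : Y) :
  fsmap f phi y != 0 -> exists2 x, f x = y & phi x != 0.
Proof. exact: fsum_neq0. Qed.

Lemma fsmap_pos (S : pzSemiRingType) (X Y : Sets) (f : X -> Y)
    (phi : fsupp S X) (x : X) : positive_semiring S ->
  phi x != 0 -> fsmap f phi (f x) != 0.
Proof.
move=> Spos px /=; rewrite (@fsumE _ _ _ _ (suppseq phi)) ?fset_uniq //.
  apply: (@sum_neq0 _ {classic X} _ _ _ x) => //; first by rewrite mem_suppseq.
  exact/asboolP.
by move=> z _; rewrite mem_suppseq.
Qed.

Lemma fsmuE (S : pzSemiRingType) (X : Sets) (Psi : fsupp S (fsupp S X)) x :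
  fsmu Psi x = integ Psi (fun phi => phi x).
Proof.
by rewrite /= fsum_integ; apply: integ_supp => phi pphi; rewrite asboolT.
Qed.

Lemma integ_fsmu (S : pzSemiRingType) (X : Sets) (Psi : fsupp S (fsupp S X))
    (g : X -> S) :
  integ (fsmu Psi) g = integ Psi (fun phi => integ phi g).
Proof.
pose I : eqType := ({classic fsupp S X} * {classic X})%type.
pose r : seq I := [seq (phi, x) | phi <- suppseq Psi, x <- suppseq phi].
have -> : fsmu Psi = push r (fun p : I => Psi p.1 * (p.1 : fsupp S X) p.2)
    (fun p : I => p.2 : X).
  apply: fsupp_eq => x; rewrite fsmuE /= big_mkcond /= big_allpairs_dep /=.
  apply: eq_bigr => phi _; rewrite -{1}(integ_val phi x) mulr_sumr.
  apply: eq_bigr => y _; rewrite (asbool_equiv_eq (Q := y = x)); last by split=> ->.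
  by case: ifP => _; rewrite ?mulr0 ?mulr1.
rewrite integ_push big_allpairs_dep; apply: eq_bigr => phi _.
by rewrite mulr_sumr; apply: eq_bigr => x _; rewrite mulrA.
Qed.

Lemma integ_dirac (S : pzSemiRingType) (X : Sets) (x : X) (g : X -> S) :
  integ (dirac S x) g = g x.
Proof.
have -> : dirac S x = push [:: tt] (fun=> 1) (fun=> x).
  by apply: fsupp_eq => y /=; rewrite big_mkcond big_seq1.
by rewrite integ_push big_seq1 mul1r.
Qed.

Lemma chiE (S : pzSemiRingType) (X : Sets) (Omega : fsupp S (cset S X))
    (u : cset S X -> fsupp S X) : chi Omega u = fsmap u Omega.
Proof.
apply: fsupp_eq => phi /=; rewrite !fsum_integ1; apply: integ_supp => A OA.
congr (if _ then _ else _); apply: asbool_equiv_eq.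
by split=> [[]|].
Qed.

Lemma cmu_setP (S : pzSemiRingType) (X : Sets) (AA : cset S (cset S X))
    (phi : fsupp S X) :
  cmu_set AA phi <->
  exists2 Omega, cset_set AA Omega &
  exists2 u : cset S X -> fsupp S X,
    forall A, Omega A != 0 -> cset_set A (u A) &
    phi = fsmu (fsmap u Omega).
Proof.
split=> [[Om AOm [_ [u uP <-] <-]]|[Om AOm [u uP ->]]].
  by exists Om => //; exists u => //; rewrite chiE.
exists Om => //; exists (chi Om u); last by rewrite chiE.
by exists u.
Qed.

Definition comb (S : pzSemiRingType) (I : Type) (X : Sets) (r : seq I)
  (w : I -> S) (p : I -> fsupp S X) : fsupp S X := fsmu (push r w p).

Lemma integ_comb (S : pzSemiRingType) (I : eqType) (X : Sets) (r : seq I)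
  (w : I -> S) (p : I -> fsupp S X) (g : X -> S) :
  integ (comb r w p) g = \sum_(i <- r) w i * integ (p i) g.
Proof. by rewrite integ_fsmu integ_push. Qed.

Lemma convex_comb (S : pzSemiRingType) (I : eqType) (X : Sets)
    (A : set (fsupp S X)) (r : seq I) (w : I -> S) (p : I -> fsupp S X) :
  convex A -> (forall i, w i != 0 -> A (p i)) -> \sum_(i <- r) w i = 1 ->
  A (comb r w p).
Proof.
move=> cA wA w1; apply: (cA (push r w p)) => [phi pphi|].
  by have [i <- /wA] := push_neq0 pphi.
by rewrite fsum_supp integ_push -[RHS]w1; apply: eq_bigr => i _; rewrite mulr1.
Qed.

Lemma averaging (S : pzSemiRingType) (Spos : positive_semiring S)
    (Sinv : semifield S) (I : eqType) (K X : Sets) (r : seq I) (w : I -> S)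
    (k : I -> K) (p : I -> fsupp S X) (A : K -> cset S X) :
  (forall i, w i != 0 -> cset_set (A (k i)) (p i)) ->
  exists2 u : K -> fsupp S X,
    forall x, push r w k x != 0 -> cset_set (A x) (u x) &
    comb r w p = fsmu (fsmap u (push r w k)).
Proof.
move=> wA; set W := push r w k.
have /choice[c cP] : forall x, exists b, W x != 0 -> W x * b = 1 /\ b * W x = 1.
  move=> x; have [W0|/eqP/Sinv[b bP]] := eqVneq (W x) 0; first by exists 0.
  by exists b.
pose u x := comb [seq i <- r | `[< k i = x >]]
  (fun i => if `[< k i = x >] then c x * w i else 0) p.
exists u.
  move=> x Wx; apply: convex_comb; first exact: cset_convex.
    move=> i; case: asboolP => [<-|_]; last by rewrite eqxx.
    by move=> ci; apply: wA; apply: contra_neq ci => ->; rewrite mulr0.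
  rewrite big_filter -[RHS](cP x Wx).2 /W /= mulr_sumr.
  by apply: eq_bigr => i ->.
apply: integ_eq => g; rewrite integ_comb integ_fsmu integ_fsmap /integ -/W.
transitivity (\sum_(x <- suppseq W) \sum_(i <- r | `[< k i = x >]) w i * integ (p i) g).
  rewrite (exchange_big_dep xpredT) //=; apply: eq_big_seq => i ir.
  have [wi|wi] := eqVneq (w i) 0.
    by rewrite wi mul0r big1 // => x _; rewrite mul0r.
  rewrite -[LHS](@big_pick _ {classic K} (suppseq W) (k i)
    (fun=> w i * integ (p i) g)) ?fset_uniq //.
  rewrite mem_suppseq => /negP[].
  by apply: (sum_neq0 (i := i)) => //; exact/asboolP.
apply: eq_big_seq => x; rewrite mem_suppseq => Wx.
rewrite [in RHS]/u -/(integ _ _) integ_comb big_filter mulr_sumr.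
by apply: eq_bigr => i ->; rewrite !mulrA (cP x Wx).1 mul1r.
Qed.

Definition fsupp0 (S : pzSemiRingType) (X : Sets) : fsupp S X :=
  push [::] (fun=> 0) id.

Lemma integ_cst (S : pzSemiRingType) (X : Sets) (phi : fsupp S X) (a : S) :
  integ phi (fun=> a) = integ phi (fun=> 1) * a.
Proof.
by rewrite /integ mulr_suml; apply: eq_bigr => x _; rewrite mulr1.
Qed.

Lemma cmap_subproof (S : pzSemiRingType) (X Y : Sets) (f : X -> Y)
    (A : cset S X) : convex (fsmap f @` A).
Proof.
move=> Psi PA P1.
have /choice[v vP] : forall phi, exists psi : fsupp S X, Psi phi != 0 ->
    cset_set A psi /\ fsmap f psi = phi.
  move=> phi; have [P0|PN0] := eqVneq (Psi phi) 0; first by exists (fsupp0 S X).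
  by have [psi Apsi <-] := PA _ PN0; exists psi.
exists (@comb S {classic fsupp S Y} X (suppseq Psi) Psi v).
  apply: convex_comb; first exact: cset_convex.
  - by move=> phi /vP[].
  - by rewrite -P1 fsum_supp /integ; apply: eq_bigr => x _; rewrite mulr1.
apply: integ_eq => g; rewrite integ_fsmap integ_comb integ_fsmu.
apply: eq_big_seq => phi; rewrite mem_suppseq => /vP[_ E].
have -> : integ phi g = integ (fsmap f (v phi)) g by rewrite E.
by rewrite integ_fsmap.
Qed.

Definition cmap (S : pzSemiRingType) (X Y : Sets) (f : X -> Y)
  (A : cset S X) : cset S Y := CSet (@cmap_subproof S X Y f A).

Lemma ceta_subproof (S : pzSemiRingType) (X : Sets) (x : X) :
  convex [set dirac S x].
Proof.
move=> Psi PA P1 /=; apply: integ_eq => g; rewrite integ_fsmu.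
rewrite (@integ_supp _ _ _ _ (fun=> integ (dirac S x) g)) => [|phi /PA -> //].
by rewrite integ_cst -fsum_supp P1 mul1r.
Qed.

Definition ceta (S : pzSemiRingType) (X : Sets) (x : X) : cset S X :=
  CSet (@ceta_subproof S X x).

Lemma average1 (S : pzSemiRingType) (Spos : positive_semiring S)
    (Sinv : semifield S) (T K X : Sets) (Theta : fsupp S T)
    (k : T -> K) (p : T -> fsupp S X) (A : K -> cset S X) :
  (forall t, Theta t != 0 -> cset_set (A (k t)) (p t)) ->
  exists2 u : K -> fsupp S X,
    forall x, fsmap k Theta x != 0 -> cset_set (A x) (u x) &
    fsmu (fsmap p Theta) = fsmu (fsmap u (fsmap k Theta)).
Proof.
move=> kA.
have [u uP E] := @averaging S Spos Sinv {classic T} K X (suppseq Theta) Theta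
  k p A kA.
have Ek : push (suppseq Theta) Theta (k : {classic T} -> K) = fsmap k Theta.
  by apply: integ_eq => g; rewrite integ_push integ_fsmap.
rewrite Ek in uP E; exists u => //; rewrite -E; apply: integ_eq => g.
by rewrite integ_comb integ_fsmu integ_fsmap.
Qed.

Lemma average2 (S : pzSemiRingType) (Spos : positive_semiring S)
    (Sinv : semifield S) (T X : Sets) (Theta : fsupp S T)
    (U : T -> fsupp S (cset S X)) (v : T -> cset S X -> fsupp S X) :
  (forall t, Theta t != 0 -> forall A, U t A != 0 -> cset_set A (v t A)) ->
  exists2 u : cset S X -> fsupp S X,
    forall A, fsmu (fsmap U Theta) A != 0 -> cset_set A (u A) &
    fsmu (fsmap (fun t => fsmu (fsmap (v t) (U t))) Theta) =
    fsmu (fsmap u (fsmu (fsmap U Theta))).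
Proof.
move=> vP; pose I : eqType := ({classic T} * {classic cset S X})%type.
pose r : seq I := [seq (t, A) | t <- suppseq Theta, A <- suppseq (U t)].
pose w (i : I) := Theta i.1 * U i.1 i.2.
pose p (i : I) := v i.1 i.2.
have wP (i : I) : w i != 0 -> cset_set i.2 (p i).
  by move=> W; apply: vP; apply: contra_neq W; rewrite /w => ->; rewrite ?mul0r ?mulr0.
have [u uP E] := @averaging S Spos Sinv I (cset S X) X r w snd p id wP.
have Ek : push r w (snd : I -> cset S X) = fsmu (fsmap U Theta).
  apply: integ_eq => g.
  rewrite integ_push integ_fsmu integ_fsmap big_allpairs_dep.
  apply: eq_bigr => t _; rewrite mulr_sumr; apply: eq_bigr => A _.
  by rewrite mulrA.
rewrite Ek in uP E; exists u => //; rewrite -E; apply: integ_eq => g.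
rewrite integ_comb integ_fsmu integ_fsmap big_allpairs_dep.
apply: eq_bigr => t _; rewrite integ_fsmu integ_fsmap mulr_sumr.
by apply: eq_bigr => A _; rewrite mulrA.
Qed.

Lemma fsmu_fsmap_id (S : pzSemiRingType) (T X : Sets) (Theta : fsupp S T)
    (p : T -> fsupp S X) (Psi : fsupp S X) :
  (forall t, Theta t != 0 -> p t = Psi) -> integ Theta (fun=> 1) = 1 ->
  fsmu (fsmap p Theta) = Psi.
Proof.
move=> pP T1; apply: integ_eq => g; rewrite integ_fsmu integ_fsmap.
rewrite (@integ_supp _ _ _ _ (fun=> integ Psi g)) => [|t /pP -> //].
by rewrite integ_cst T1 mul1r.
Qed.

Lemma supp_choice (S : pzSemiRingType) (X : Sets) (Theta : fsupp S X)
    (T : Type) (t0 : T) (R : X -> T -> Prop) :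
  (forall x, Theta x != 0 -> exists t, R x t) ->
  exists v : X -> T, forall x, Theta x != 0 -> R x (v x).
Proof.
move=> TR; have /choice[v vP] : forall x, exists t, Theta x != 0 -> R x t.
  move=> x; have [T0|/TR[t Rt]] := eqVneq (Theta x) 0; first by exists t0.
  by exists t.
by exists v.
Qed.

Lemma cmu_subproof (S : pzSemiRingType) (Spos : positive_semiring S)
    (Sinv : semifield S) (X : Sets) (AA : cset S (cset S X)) :
  convex (cmu_set AA).
Proof.
move=> Psi PA P1.
have [|v vP] := @supp_choice S _ Psi
  (fsupp S (cset S X) * (cset S X -> fsupp S X))%type
  (fsupp0 S _, fun=> fsupp0 S X)
  (fun phi p => [/\ cset_set AA p.1,
    forall A, p.1 A != 0 -> cset_set A (p.2 A) &
    phi = fsmu (fsmap p.2 p.1)]).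
  by move=> phi /PA/cmu_setP[Om AOm [u uP E]]; exists (Om, u).
have [|u uP E] := @average2 S Spos Sinv (fsupp S X) X Psi
  (fun phi => (v phi).1) (fun phi => (v phi).2).
  by move=> phi /vP[].
apply/cmu_setP; exists (fsmu (fsmap (fun phi => (v phi).1) Psi)); last first.
  exists u => //; rewrite -E; apply: integ_eq => g.
  rewrite !integ_fsmu integ_fsmap; apply: integ_supp => phi /vP[_ _ E'].
  by rewrite {1}E'.
apply: (cset_convex (c := AA)).
  by move=> Om OmP; have [phi <- /vP[]] := fsmap_neq0 OmP.
by rewrite fsum_supp integ_fsmap -fsum_supp.
Qed.

Definition cmu (S : pzSemiRingType) (Spos : positive_semiring S)
  (Sinv : semifield S) (X : Sets) (AA : cset S (cset S X)) : cset S X :=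
  CSet (@cmu_subproof S Spos Sinv X AA).

Lemma cmap1 (S : pzSemiRingType) (X : Sets) (A : cset S X) :
  cmap id A = A.
Proof.
have E (phi : fsupp S X) : fsmap id phi = phi.
  by apply: integ_eq => g; rewrite integ_fsmap.
apply: cset_eq => phi; split=> [[psi Apsi <-]|Aphi]; first by rewrite E.
by exists phi.
Qed.

Lemma fsmapM (S : pzSemiRingType) (X Y Z : Sets) (g : Y -> Z) (f : X -> Y)
  (phi : fsupp S X) : fsmap (fun x => g (f x)) phi = fsmap g (fsmap f phi).
Proof. by apply: integ_eq => h; rewrite !integ_fsmap. Qed.

Lemma cmapM (S : pzSemiRingType) (X Y Z : Sets) (g : Y -> Z) (f : X -> Y)
    (A : cset S X) :
  cmap (fun x => g (f x)) A = cmap g (cmap f A).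
Proof.
apply: cset_eq => phi; split=> [[psi Apsi <-]|[_ [psi Apsi <-] <-]].
  by rewrite fsmapM; exists (fsmap f psi) => //; exists psi.
by exists psi => //; rewrite fsmapM.
Qed.

Lemma fsmap_dirac (S : pzSemiRingType) (X Y : Sets) (f : X -> Y) (x : X) :
  fsmap f (dirac S x) = dirac S (f x).
Proof. by apply: integ_eq => g; rewrite integ_fsmap !integ_dirac. Qed.

Lemma fsmu_dirac (S : pzSemiRingType) (X : Sets) (phi : fsupp S X) :
  fsmu (dirac S phi) = phi.
Proof. by apply: integ_eq => g; rewrite integ_fsmu integ_dirac. Qed.

Lemma dirac_neq0 (S : pzSemiRingType) (X : Sets) (x y : X) :
  dirac S x y != 0 -> x = y.
Proof. by rewrite /=; case: asboolP => //; rewrite eqxx. Qed.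

Lemma ceta_nat (S : pzSemiRingType) (X Y : Sets) (f : X -> Y) (x : X) :
  ceta S (f x) = cmap f (ceta S x).
Proof.
apply: cset_eq => phi; split=> [->|[_ -> <-]] /=; last by rewrite fsmap_dirac.
by exists (dirac S x) => //; rewrite fsmap_dirac.
Qed.

Lemma cmu_nat (S : pzSemiRingType) (Spos : positive_semiring S)
    (Sinv : semifield S) (X Y : Sets) (f : X -> Y) (AA : cset S (cset S X)) :
  cmu Spos Sinv (cmap (cmap f) AA) = cmap f (cmu Spos Sinv AA).
Proof.
apply: cset_eq => phi; split.
  case/cmu_setP => _ [Om AOm <-] [u uP ->].
  have [|v vP] := @supp_choice S _ Om (fsupp S X) (fsupp0 S X)
    (fun A psi => cset_set A psi /\ fsmap f psi = u (cmap f A)).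
    move=> A /(fsmap_pos (cmap f) Spos)/uP[psi Apsi E]; by exists psi.
  exists (fsmu (fsmap v Om)).
    by apply/cmu_setP; exists Om => //; exists v => // A /vP[].
  apply: integ_eq => g; rewrite !(integ_fsmu, integ_fsmap).
  by apply: integ_supp => A /vP[_ <-]; rewrite integ_fsmap.
case=> _ /cmu_setP[Om AOm [u uP ->]] <-.
have [|v vP E] := @average1 S Spos Sinv (cset S X) (cset S Y) Y Om (cmap f)
  (fun A => fsmap f (u A)) id.
  by move=> A /uP Au; exists (u A).
apply/cmu_setP; exists (fsmap (cmap f) Om); first by exists Om.
exists v => //; rewrite -E; apply: integ_eq => g.
rewrite !(integ_fsmu, integ_fsmap).
by apply: integ_supp => A _; rewrite integ_fsmap.
Qed.

Lemma cmu_unitl (S : pzSemiRingType) (Spos : positive_semiring S)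
    (Sinv : semifield S) (X : Sets) (A : cset S X) :
  cmu Spos Sinv (ceta S A) = A.
Proof.
apply: cset_eq => phi; split.
  case/cmu_setP => _ -> [u uP ->]; rewrite fsmap_dirac fsmu_dirac.
  have [A0|AN0] := eqVneq (dirac S A A) 0; last exact: uP.
  have S0 (a b : S) : a = b.
    move: A0 => /=; rewrite asboolT // => a1.
    by rewrite -[a]mul1r -[b]mul1r a1 !mul0r.
  have -> : u A = fsmu (fsupp0 S _) by apply: fsupp_eq => x; exact: S0.
  apply: (cset_convex (c := A)) => [psi|]; last exact: S0.
  by rewrite /supp /= (S0 (\sum_(_ <- _ | _) _) 0) eqxx.
move=> Aphi; apply/cmu_setP; exists (dirac S A) => //; exists (fun=> phi).
  by move=> B BN0; rewrite -(@dirac_neq0 S _ A B BN0).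
by rewrite fsmap_dirac fsmu_dirac.
Qed.

Lemma fsmu_fsmap_dirac (S : pzSemiRingType) (X : Sets) (phi : fsupp S X) :
  fsmu (fsmap (@dirac S X) phi) = phi.
Proof.
apply: integ_eq => g; rewrite integ_fsmu integ_fsmap.
by apply: integ_supp => x _; rewrite integ_dirac.
Qed.

Lemma cmu_unitr (S : pzSemiRingType) (Spos : positive_semiring S)
    (Sinv : semifield S) (X : Sets) (A : cset S X) :
  cmu Spos Sinv (cmap (@ceta S X) A) = A.
Proof.
have key (Om : fsupp S X) (u : cset S X -> fsupp S X) :
    (forall B, fsmap (@ceta S X) Om B != 0 -> cset_set B (u B)) ->
    fsmu (fsmap u (fsmap (@ceta S X) Om)) = Om.
  move=> uP; rewrite -[RHS]fsmu_fsmap_dirac; apply: integ_eq => g.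
  rewrite !(integ_fsmu, integ_fsmap); apply: integ_supp => x.
  by move/(fsmap_pos (@ceta S X) Spos)/uP ->.
apply: cset_eq => phi; split.
  by case/cmu_setP => _ [Om AOm <-] [u uP ->]; rewrite key.
move=> Aphi; apply/cmu_setP; exists (fsmap (@ceta S X) phi); first by exists phi.
have [|u uP] := @supp_choice S _ (fsmap (@ceta S X) phi) (fsupp S X)
  (fsupp0 S X) (fun B psi => cset_set B psi).
  by move=> B BN0; have [x <- _] := fsmap_neq0 BN0; exists (dirac S x).
by exists u => //; rewrite key.
Qed.

Lemma semifield_mul_neq0 (S : pzSemiRingType) (Sinv : semifield S) (a b : S) :
  a != 0 -> b != 0 -> a * b != 0.
Proof.
move=> /eqP/Sinv[c [_ ca]] bN0; apply: contra_neq bN0 => ab.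
by rewrite -[b]mul1r -ca -mulrA ab mulr0.
Qed.

Lemma integ_neq0 (S : pzSemiRingType) (Spos : positive_semiring S)
    (Sinv : semifield S) (X : Sets) (phi : fsupp S X) (g : X -> S) (x : X) :
  phi x != 0 -> g x != 0 -> integ phi g != 0.
Proof.
move=> px gx; apply: (@sum_neq0 _ {classic X} _ _ _ x) => //.
  by rewrite mem_suppseq.
exact: semifield_mul_neq0.
Qed.

Lemma cmuA (S : pzSemiRingType) (Spos : positive_semiring S)
    (Sinv : semifield S) (X : Sets) (AAA : cset S (cset S (cset S X))) :
  cmu Spos Sinv (cmu Spos Sinv AAA) =
  cmu Spos Sinv (cmap (@cmu S Spos Sinv X) AAA).
Proof.
set mu := @cmu S Spos Sinv X.
apply: cset_eq => phi; split.
  case/cmu_setP => _ /cmu_setP[Th ATh [U UP ->]] [u uP ->].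
  have [|v vP E] := @average1 S Spos Sinv _ (cset S X) X Th mu
    (fun AA => fsmu (fsmap u (U AA))) id.
    move=> AA ThAA; apply/cmu_setP; exists (U AA); first exact: UP.
    exists u => // A UA; apply: uP; rewrite fsmuE integ_fsmap.
    exact: (integ_neq0 Spos Sinv ThAA UA).
  apply/cmu_setP; exists (fsmap mu Th); first by exists Th.
  exists v => //; rewrite -E; apply: integ_eq => g.
  rewrite !(integ_fsmu, integ_fsmap).
  by apply: integ_supp => AA _; rewrite integ_fsmu integ_fsmap.
case/cmu_setP => _ [Th ATh <-] [v vP ->].
have [|t tP] := @supp_choice S _ Th
  (fsupp S (cset S X) * (cset S X -> fsupp S X))%type
  (fsupp0 S _, fun=> fsupp0 S X)
  (fun AA p => [/\ cset_set AA p.1,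
    forall A, p.1 A != 0 -> cset_set A (p.2 A) &
    v (mu AA) = fsmu (fsmap p.2 p.1)]).
  move=> AA /(fsmap_pos mu Spos)/vP/cmu_setP[Om AOm [u uP E]].
  by exists (Om, u).
have [|u uP E] := @average2 S Spos Sinv _ X Th
  (fun AA => (t AA).1) (fun AA => (t AA).2).
  by move=> AA /tP[].
apply/cmu_setP; exists (fsmu (fsmap (fun AA => (t AA).1) Th)).
  apply/cmu_setP; exists Th => //; exists (fun AA => (t AA).1) => //.
  by move=> AA /tP[].
exists u => //; rewrite -E; apply: integ_eq => g.
rewrite !(integ_fsmu, integ_fsmap).
by apply: integ_supp => AA /tP[_ _ ->].
Qed.

Definition convex_functor (S : pzSemiRingType) : functor SetCat SetCat.
Proof.
refine (@Functor SetCat SetCat (fun X : Sets => cset S X)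
  (fun X Y f => @cmap S X Y f) _ _).
- by move=> X; apply/funext => A; exact: cmap1.
- by move=> X Y Z g f; apply/funext => A; exact: cmapM.
Defined.

Definition convex_monad (S : pzSemiRingType) (Spos : positive_semiring S)
  (Sinv : semifield S) : monad SetCat.
Proof.
refine (@Monad SetCat (convex_functor S) (@ceta S) (@cmu S Spos Sinv)
  _ _ _ _ _).
- by move=> X Y f; apply/funext => x; exact: ceta_nat.
- by move=> X Y f; apply/funext => A; exact: cmu_nat.
- by move=> X; apply/funext => A; exact: cmu_unitl.
- by move=> X; apply/funext => A; exact: cmu_unitr.
- by move=> X; apply/funext => A; exact: cmuA.
Defined.

Record alg (S : pzSemiRingType) := Alg {
  alg_car : Sets;
  asup : forall I : Sets, (I -> alg_car) -> alg_car;
  aadd : alg_car -> alg_car -> alg_car;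
  azero : alg_car;
  ascale : S -> alg_car -> alg_car;
  asup_unit : forall x : unit -> alg_car, asup x = x tt;
  asup_surj : forall (I J : Sets) (f : I -> J) (x : J -> alg_car),
    (forall j, exists i, f i = j) -> asup x = asup (fun i => x (f i));
  asup_fibers : forall (I J : Sets) (f : I -> J) (x : I -> alg_car),
    asup x = asup (fun j : J => asup (fun i : {i : I | f i = j} => x (sval i)));
  aaddA : forall x y z, aadd x (aadd y z) = aadd (aadd x y) z;
  aaddC : forall x y, aadd x y = aadd y x;
  aadd0 : forall x, aadd x azero = x;
  ascale_zero : forall l, ascale l azero = azero;
  ascale0 : forall x, ascale 0 x = azero;
  ascale1 : forall x, ascale 1 x = x;
  ascaleM : forall l m x, ascale (l * m) x = ascale l (ascale m x);
  ascaleDr : forall l x y, ascale l (aadd x y) = aadd (ascale l x) (ascale l y);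
  ascaleDl : forall l m x, ascale (l + m) x = aadd (ascale l x) (ascale m x);
  ascale_sup : forall l (I : Sets) (x : I -> alg_car), l <> 0 ->
    ascale l (asup x) = asup (fun i => ascale l (x i));
  aadd_sup : forall (I J : Sets) (x : I -> alg_car) (y : J -> alg_car),
    aadd (asup x) (asup y) = asup (fun p : I * J => aadd (x p.1) (y p.2)) }.

Arguments asup {S} a {I} x.
Arguments aadd {S a} x y.
Arguments azero {S} a.
Arguments ascale {S a} l x.

Record alg_hom (S : pzSemiRingType) (X Y : alg S) := AlgHom {
  alg_fun :> alg_car X -> alg_car Y;
  alg_fun_sup : forall (I : Sets) (x : I -> alg_car X),
    alg_fun (asup X x) = asup Y (fun i => alg_fun (x i));
  alg_fun_add : forall x y, alg_fun (aadd x y) = aadd (alg_fun x) (alg_fun y);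
  alg_fun_zero : alg_fun (azero X) = azero Y;
  alg_fun_scale : forall l x, alg_fun (ascale l x) = ascale l (alg_fun x) }.

Lemma alg_hom_eq (S : pzSemiRingType) (X Y : alg S) (f g : alg_hom X Y) :
  alg_fun f = alg_fun g -> f = g.
Proof.
case: f g => f f1 f2 f3 f4 [g g1 g2 g3 g4] /= fg.
rewrite -{g}fg in g1 g2 g3 g4 *.
rewrite (Prop_irrelevance f1 g1) (Prop_irrelevance f2 g2).
by rewrite (Prop_irrelevance f3 g3) (Prop_irrelevance f4 g4).
Qed.

Definition alg_id (S : pzSemiRingType) (X : alg S) : alg_hom X X :=
  @AlgHom S X X id (fun _ _ => erefl) (fun _ _ => erefl) erefl
    (fun _ _ => erefl).

Definition alg_comp (S : pzSemiRingType) (X Y Z : alg S)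
  (g : alg_hom Y Z) (f : alg_hom X Y) : alg_hom X Z.
Proof.
refine (@AlgHom S X Z (fun x => g (f x)) _ _ _ _).
- by move=> I x; rewrite !alg_fun_sup.
- by move=> x y; rewrite !alg_fun_add.
- by rewrite !alg_fun_zero.
- by move=> l x; rewrite !alg_fun_scale.
Defined.

Definition AlgCat (S : pzSemiRingType) : category.
Proof.
refine (@Category (alg S) (@alg_hom S) (@alg_id S) (@alg_comp S) _ _ _).
- by move=> X Y f; exact: alg_hom_eq.
- by move=> X Y f; exact: alg_hom_eq.
- by move=> X Y Z W h g f; exact: alg_hom_eq.
Defined.

Definition alg_forget (S : pzSemiRingType) : functor (AlgCat S) SetCat :=
  @Functor (AlgCat S) SetCat (@alg_car S) (fun X Y => @alg_fun S X Y)
    (fun=> erefl) (fun _ _ _ _ _ => erefl).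

(* Main.v *)
(* For an Eilenberg-Moore algebra [a : C E -> E], every [t] in [C I] is an
   [I]-ary operation [x |-> a (C x t)] on [E].  On the free algebra [C X] the
   operations coming from the theory are explicit (convex hull of a union,
   Minkowski sum, dilation), so its equations are checked on elements; [a] is a
   homomorphism from [C E] onto [E], which therefore satisfies them too.
   Conversely a (Sigma, E)-algebra [X] evaluates a convex set [A] to the
   supremum of the linear combinations given by its elements; compatibility
   with the multiplication of [C] is the distributivity of finite linear
   combinations over suprema.  The two passages are mutually inverse because
   [A] is the hull of its singletons, and because the hull of a set of
   generators has the same supremum as the set. *)
From HB Require Import structures.
From mathcomp Require Import all_boot all_algebra.
From mathcomp Require Import finmap.
From mathcomp Require Import boolp classical_sets.
Require Import Defs.

Set Implicit Arguments.
Unset Strict Implicit.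
Unset Printing Implicit Defensive.

Import GRing.Theory.
Local Open Scope classical_set_scope.
Local Open Scope ring_scope.

(** * Equality of functors and of structured objects *)

Lemma functor_eq_hom (A B : category) (o : A -> B)
    (m1 m2 : forall X Y : A, hom X Y -> hom (o X) (o Y)) p1 q1 p2 q2 :
  (forall X Y f, m1 X Y f = m2 X Y f) ->
  @Functor A B o m1 p1 q1 = @Functor A B o m2 p2 q2.
Proof.
move=> m12; have {}m12 : m1 = m2.
  by do 3 apply: functional_extensionality_dep => ?; exact: m12.
rewrite -{m2}m12 in p2 q2 *.
by rewrite (Prop_irrelevance p1 p2) (Prop_irrelevance q1 q2).
Qed.

(** The type of an action on morphisms depends on the object map, so the actions are compared by
    transport along an equality of object maps, which proof irrelevance makes trivial. *)
Lemma functor_inj_hom (A B : category) (o : A -> B)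
    (m1 m2 : forall X Y : A, hom X Y -> hom (o X) (o Y)) p1 q1 p2 q2 :
  @Functor A B o m1 p1 q1 = @Functor A B o m2 p2 q2 ->
  forall X Y f, m1 X Y f = m2 X Y f.
Proof.
move=> e X Y f.
have tr (F G : functor A B) (FG : F = G) (o_eq : fobj F = fobj G) :
    eq_rect (fobj F) (fun o : A -> B => hom (o X) (o Y)) (fmap F f) (fobj G) o_eq
    = fmap G f.
  by case: _ / FG o_eq => o_eq; rewrite (Prop_irrelevance o_eq erefl).
exact: (tr _ _ e erefl).
Qed.

(** Since [U] is faithful, the equation on images under [U] determines the action on morphisms once
    [H] is the identity on objects. *)
Lemma functor_id_eq (A B : category) (U : functor A B) (H : functor A A) :
  (forall X Y (f g : hom X Y), fmap U f = fmap U g -> f = g) ->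
  (forall X, H X = X) -> functor_comp U H = U -> H = functor_id A.
Proof.
case: H => o m p q Uinj oid UH.
have {}oid : o = id by apply/funext.
subst o; apply: functor_eq_hom => X Y f; apply: (Uinj _ _ (m X Y f)).
by case: U UH {Uinj} => oU mU pU qU /functor_inj_hom; apply.
Qed.

Lemma EM_obj_eq (B : category) (M : monad B) (X : B) (a b : hom (M X) X) pa qa
  pb qb : a = b -> @EMObj B M X a pa qa = @EMObj B M X b pb qb.
Proof.
move=> ab; rewrite -{b}ab in pb qb *.
by rewrite (Prop_irrelevance pa pb) (Prop_irrelevance qa qb).
Qed.

(** Equality of all operations is packaged as a homomorphism lying over the cast between carriers.
    When the cast is trivial, [f] is the identity and each preservation law equates two
    operations. *)
Lemma alg_eq (S : pzSemiRingType) (X Y : alg S)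
    (XY : alg_car X = alg_car Y) (f : alg_hom X Y) :
  (forall x, f x = eq_rect _ id x _ XY) -> X = Y.
Proof.
case: X Y XY f => X s a z c p1 p2 p3 p4 p5 p6 p7 p8 p9 p10 p11 p12 p13 p14.
move=> [Y s' a' z' c' q1 q2 q3 q4 q5 q6 q7 q8 q9 q10 q11 q12 q13 q14] /= XY.
case: _ / XY s' a' z' c' q1 q2 q3 q4 q5 q6 q7 q8 q9 q10 q11 q12 q13 q14.
move=> s' a' z' c' q1 q2 q3 q4 q5 q6 q7 q8 q9 q10 q11 q12 q13 q14.
move=> [f /= fs fa fz fc] fid; have {}fid : f = id by apply/funext.
subst f.
have ss : s = s'.
  by apply: functional_extensionality_dep => I; apply/funext => x; exact: fs.
have aa : a = a' by apply/funext => x; apply/funext => y; exact: fa.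
have cc : c = c' by apply/funext => l; apply/funext => x; exact: fc.
subst s' a' c'; rewrite /= in fz; subst z'; congr Alg; exact: Prop_irrelevance.
Qed.

(** * Finite linear combinations in a semimodule *)

Section LinearCombination.
Variables (S : pzSemiRingType) (V : lSemiModType S).
Implicit Types X Y : Sets.

Definition lincomb X (phi : fsupp S X) (g : X -> V) : V :=
  \sum_(x <- suppseq phi) phi x *: g x.

Lemma lincomb_seq X (phi : fsupp S X) (g : X -> V) (r : seq {classic X}) :
  uniq r -> (forall x, phi x != 0 -> (x : {classic X}) \in r) ->
  lincomb phi g = \sum_(x <- r) phi x *: g x.
Proof.
move=> ur rP.
have N0 x : phi x *: g x != 0 -> phi x != 0.
  by apply: contra_neq => ->; rewrite scale0r.
rewrite /lincomb.
transitivity (fsum setT (fun x => phi x *: g x)); last first.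
  rewrite (fsumE ur) => [|x _ /N0/rP //].
  by apply: eq_bigl => x; exact/asboolP.
rewrite (@fsumE _ _ _ _ (suppseq phi)) ?fset_uniq //.
  by apply: eq_bigl => x; exact/esym/asboolP.
by move=> x _ /N0; rewrite mem_suppseq.
Qed.

Lemma lincomb_push (I : eqType) X (r : seq I) (w : I -> S) (k : I -> X)
    (g : X -> V) :
  lincomb (push r w k) g = \sum_(i <- r) w i *: g (k i).
Proof.
pose kc : I -> {classic X} := k.
pose s : seq {classic X} := undup (map kc r).
have us : uniq s by exact: undup_uniq.
rewrite (@lincomb_seq _ _ _ s) //; last first.
  move=> x; apply: contraNT => /= xs.
  rewrite big_seq_cond big_pred0 // => i; apply/negbTE/negP => /andP[ir /asboolP kx].
  by move: xs; rewrite mem_undup -kx (map_f kc).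
under eq_bigr => x _ do rewrite /= scaler_suml.
rewrite (exchange_big_dep xpredT) //=; apply: eq_big_seq => i ir.
rewrite -[RHS](@big_pick V {classic X} s (k i) (fun x => w i *: g x)) //.
by rewrite mem_undup (map_f kc).
Qed.

Lemma push_fsupp X (phi : fsupp S X) :
  push (suppseq phi) phi (id : {classic X} -> X) = phi.
Proof. by apply: integ_eq => g; rewrite integ_push. Qed.

Lemma lincomb_dirac X (x : X) (g : X -> V) : lincomb (dirac S x) g = g x.
Proof.
have -> : dirac S x = push [:: tt] (fun=> 1) (fun=> x).
  by apply: integ_eq => h; rewrite integ_push integ_dirac big_seq1 mul1r.
by rewrite lincomb_push big_seq1 scale1r.
Qed.

Lemma lincomb_fsmap X Y (f : X -> Y) (phi : fsupp S X) (g : Y -> V) :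
  lincomb (fsmap f phi) g = lincomb phi (fun x => g (f x)).
Proof.
have -> : fsmap f phi = push (suppseq phi) phi (f : {classic X} -> Y).
  by apply: integ_eq => h; rewrite integ_push integ_fsmap.
by rewrite (lincomb_push _ _ (f : {classic X} -> Y)).
Qed.

(** With [fsmu Psi] written as the push-forward of the weights [Psi phi * phi x] on pairs
    [(phi, x)], both sides become the same double sum. *)
Lemma lincomb_fsmu X (Psi : fsupp S (fsupp S X)) (g : X -> V) :
  lincomb (fsmu Psi) g = lincomb Psi (fun phi => lincomb phi g).
Proof.
pose I : eqType := ({classic fsupp S X} * {classic X})%type.
pose r : seq I := [seq (phi, x) | phi <- suppseq Psi, x <- suppseq phi].
have -> : fsmu Psi = push r (fun p : I => Psi p.1 * (p.1 : fsupp S X) p.2)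
    (fun p : I => p.2 : X).
  apply: integ_eq => h; rewrite integ_fsmu integ_push big_allpairs_dep.
  apply: eq_bigr => phi _; rewrite mulr_sumr.
  by apply: eq_bigr => x _; rewrite mulrA.
rewrite lincomb_push big_allpairs_dep; apply: eq_bigr => phi _.
by rewrite scaler_sumr; apply: eq_bigr => x _; rewrite scalerA.
Qed.

Lemma lincomb_supp X (phi : fsupp S X) (g h : X -> V) :
  (forall x, phi x != 0 -> g x = h x) -> lincomb phi g = lincomb phi h.
Proof.
by move=> gh; apply: eq_big_seq => x; rewrite mem_suppseq => /gh ->.
Qed.

End LinearCombination.

(** * The free semimodule and its convex subsets *)

Section FreeModuleOps.
Variable S : pzSemiRingType.
Implicit Types X Y I : Sets.

Definition fadd X (phi psi : fsupp S X) : fsupp S X :=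
  comb [:: true; false] (fun=> 1) (fun b => if b then phi else psi).

Definition fscale X (l : S) (phi : fsupp S X) : fsupp S X :=
  comb [:: tt] (fun=> l) (fun=> phi).

(** Kleisli extension for finitely supported functions: the combination of the [v i] with
    coefficients [theta i]. *)
Definition fbind I X (theta : fsupp S I) (v : I -> fsupp S X) : fsupp S X :=
  fsmu (fsmap v theta).

Lemma integ_fadd X (phi psi : fsupp S X) g :
  integ (fadd phi psi) g = integ phi g + integ psi g.
Proof. by rewrite integ_comb !big_cons big_nil !mul1r addr0. Qed.

Lemma integ_fscale X l (phi : fsupp S X) g :
  integ (fscale l phi) g = l * integ phi g.
Proof. by rewrite integ_comb big_seq1. Qed.

Lemma lincomb_fadd (V : lSemiModType S) X (phi psi : fsupp S X) (g : X -> V) :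
  lincomb (fadd phi psi) g = lincomb phi g + lincomb psi g.
Proof.
by rewrite lincomb_fsmu lincomb_push !big_cons big_nil !scale1r addr0.
Qed.

Lemma lincomb_fscale (V : lSemiModType S) X l (phi : fsupp S X) (g : X -> V) :
  lincomb (fscale l phi) g = l *: lincomb phi g.
Proof. by rewrite lincomb_fsmu lincomb_push big_seq1. Qed.

Lemma lincomb_fsupp0 (V : lSemiModType S) X (g : X -> V) :
  lincomb (fsupp0 S X) g = 0.
Proof.
by rewrite /fsupp0 (@lincomb_push _ _ {classic X} X _ _ (id : {classic X} -> X))
  big_nil.
Qed.

Lemma integ_fsupp0 X g : integ (fsupp0 S X) g = 0.
Proof.
by rewrite /fsupp0 (@integ_push _ {classic X} X _ _ (id : {classic X} -> X))
  big_nil.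
Qed.

Lemma integ_fbind I X (theta : fsupp S I) (v : I -> fsupp S X) g :
  integ (fbind theta v) g = integ theta (fun i => integ (v i) g).
Proof. by rewrite integ_fsmu integ_fsmap. Qed.

Lemma integD I (theta : fsupp S I) (g h : I -> S) :
  integ theta (fun i => g i + h i) = integ theta g + integ theta h.
Proof.
by rewrite /integ -big_split; apply: eq_bigr => i _; rewrite mulrDr.
Qed.

Lemma eq_fbind I X (theta : fsupp S I) (v v' : I -> fsupp S X) :
  (forall i, theta i != 0 -> v i = v' i) -> fbind theta v = fbind theta v'.
Proof.
move=> vv'; apply: integ_eq => g; rewrite !integ_fbind.
by apply: integ_supp => i /vv' ->.
Qed.

Lemma fadd0 X (phi : fsupp S X) : fadd phi (fsupp0 S X) = phi.
Proof.
by apply: integ_eq => g; rewrite integ_fadd integ_fsupp0 addr0.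
Qed.

Lemma faddC X (phi psi : fsupp S X) : fadd phi psi = fadd psi phi.
Proof. by apply: integ_eq => g; rewrite !integ_fadd addrC. Qed.

Lemma faddA X (phi psi rho : fsupp S X) :
  fadd phi (fadd psi rho) = fadd (fadd phi psi) rho.
Proof. by apply: integ_eq => g; rewrite !integ_fadd addrA. Qed.

Lemma fscale0 X (phi : fsupp S X) : fscale 0 phi = fsupp0 S X.
Proof.
by apply: integ_eq => g; rewrite integ_fscale integ_fsupp0 mul0r.
Qed.

Lemma fscale_fsupp0 X l : fscale l (fsupp0 S X) = fsupp0 S X.
Proof.
by apply: integ_eq => g; rewrite integ_fscale integ_fsupp0 mulr0.
Qed.

Lemma fscale1 X (phi : fsupp S X) : fscale 1 phi = phi.
Proof. by apply: integ_eq => g; rewrite integ_fscale mul1r. Qed.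

Lemma fscaleA X l m (phi : fsupp S X) :
  fscale l (fscale m phi) = fscale (l * m) phi.
Proof. by apply: integ_eq => g; rewrite !integ_fscale mulrA. Qed.

Lemma fscaleDr X l (phi psi : fsupp S X) :
  fscale l (fadd phi psi) = fadd (fscale l phi) (fscale l psi).
Proof.
by apply: integ_eq => g; rewrite !(integ_fscale, integ_fadd) mulrDr.
Qed.

Lemma fscaleDl X l m (phi : fsupp S X) :
  fscale (l + m) phi = fadd (fscale l phi) (fscale m phi).
Proof.
by apply: integ_eq => g; rewrite !(integ_fscale, integ_fadd) mulrDl.
Qed.

(** Pushing [theta] forward along [v] keeps the total weight, so convexity also applies to indexed
    families with repetitions. *)
Lemma convex_fbind I X (A : cset S X) (theta : fsupp S I) (v : I -> fsupp S X) :
  integ theta (fun=> 1) = 1 -> (forall i, theta i != 0 -> cset_set A (v i)) ->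
  cset_set A (fbind theta v).
Proof.
move=> theta1 vA; apply: (cset_convex (c := A)).
  by move=> phi phiN0; have [i <- /vA] := fsmap_neq0 phiN0.
by rewrite fsum_supp integ_fsmap.
Qed.

Lemma fbind_convex X (A : set (fsupp S X)) :
  (forall (theta : fsupp S (fsupp S X)) (v : fsupp S X -> fsupp S X),
    integ theta (fun=> 1) = 1 ->
    (forall i, theta i != 0 -> A (v i)) -> A (fbind theta v)) -> convex A.
Proof.
move=> Ab Psi PA P1; have := Ab Psi id; rewrite /fbind.
have -> : fsmap id Psi = Psi.
  by apply: integ_eq => g; rewrite integ_fsmap.
by apply; rewrite -?fsum_supp.
Qed.

Lemma integ_cst1 I (theta : fsupp S I) a :
  integ theta (fun=> 1) = 1 -> integ theta (fun=> a) = a.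
Proof. by move=> theta1; rewrite integ_cst theta1 mul1r. Qed.

Lemma csingle_subproof X (phi : fsupp S X) : convex [set phi].
Proof.
apply: fbind_convex => theta v theta1 vP; rewrite /= (eq_fbind (v' := fun=> phi) vP).
apply: integ_eq => g; rewrite integ_fbind; exact: integ_cst1.
Qed.

Definition csingle X (phi : fsupp S X) : cset S X :=
  CSet (@csingle_subproof X phi).

Lemma cdist_subproof I : convex [set theta : fsupp S I | integ theta (fun=> 1) = 1].
Proof.
apply: fbind_convex => theta v theta1 vP /=; rewrite integ_fbind.
by rewrite (integ_supp vP).
Qed.

(** The convex hull of the Dirac functions on [I]; as an [I]-ary operation it is the supremum. *)
Definition cdist I : cset S I := CSet (@cdist_subproof I).

(* If [1 = 0], the empty combination has total weight [1]. *)
Lemma trivial_cset X (A : cset S X) (phi : fsupp S X) :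
  1 = 0 :> S -> cset_set A phi.
Proof.
move=> S1; have S0 (a b : S) : a = b by rewrite -[a]mul1r -[b]mul1r S1 !mul0r.
rewrite (_ : phi = fbind (fsupp0 S unit) (fun=> phi)).
  by apply: convex_fbind => [|i]; [exact: S0|rewrite (S0 (fsupp0 _ _ _) 0) eqxx].
by apply: fsupp_eq => x; exact: S0.
Qed.

End FreeModuleOps.

(** * The operations and equations of the theory on convex subsets *)

Section FreeAlgebra.
Variables (S : pzSemiRingType) (Spos : positive_semiring S).
Hypothesis Sfield : semifield S.
Implicit Types X Y I J : Sets.

Local Notation mu := (@cmu S Spos Sfield _).

Definition cop I X (t : cset S I) (A : I -> cset S X) : cset S X :=
  mu (cmap A t).

(** The multiplication chooses one element per set [A i], whereas here one is chosen per index [i].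
    When several indices share a set, [average1] replaces their choices by a weighted average, which
    convexity keeps in the set. *)
Lemma copP I X (t : cset S I) (A : I -> cset S X) phi :
  cset_set (cop t A) phi <->
  exists2 theta, cset_set t theta &
  exists2 v, forall i, theta i != 0 -> cset_set (A i) (v i) &
    phi = fbind theta v.
Proof.
split=> [/cmu_setP[_ [theta ttheta <-] [u uP ->]]|[theta ttheta [v vP ->]]].
  exists theta => //; exists (fun i => u (A i)).
    by move=> i /(fsmap_pos A Spos)/uP.
  by rewrite -fsmapM.
have [u uP E] := @average1 S Spos Sfield I (cset S X) X theta A v id vP.
by apply/cmu_setP; exists (fsmap A theta); [exists theta|exists u].
Qed.

Definition csup I X (A : I -> cset S X) : cset S X := cop (cdist S I) A.

(** Terms for the remaining operations: the formal sum of two generators, the zero over no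
    generators, and the multiple by [l] of a single generator. *)
Definition tadd : cset S bool :=
  csingle (push [:: true; false] (fun=> 1) id).
Definition tzero : cset S void := csingle (fsupp0 S void).
Definition tscale (l : S) : cset S unit := csingle (push [:: tt] (fun=> l) id).

Definition cadd X (A B : cset S X) : cset S X :=
  cop tadd (fun b => if b then A else B).
Definition czero X : cset S X := cop tzero (fun i : void => match i with end).
Definition cscale X (l : S) (A : cset S X) : cset S X :=
  cop (tscale l) (fun=> A).

Lemma caddP X (A B : cset S X) phi :
  cset_set (cadd A B) phi <->
  exists2 a, cset_set A a & exists2 b, cset_set B b & phi = fadd a b.
Proof.
have E (v : bool -> fsupp S X) :
    fbind (push [:: true; false] (fun=> 1) id) v = fadd (v true) (v false).
  apply: integ_eq => g; rewrite integ_fbind integ_push integ_fadd.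
  by rewrite !big_cons big_nil !mul1r addr0.
split=> [/copP[_ -> [v vP ->]]|[a Aa [b Bb ->]]].
  (* If [1 = 0], both weights vanish and [vP] says nothing, but then every convex set contains
     everything. *)
  have [S1|S1] := eqVneq (1 : S) 0.
    by exists (v true); [|exists (v false)]; rewrite ?E //; exact: trivial_cset.
  exists (v true).
    by apply: (vP true); rewrite /= !big_cons big_nil asboolT // asboolF // addr0.
  exists (v false); last exact: E.
  by apply: (vP false); rewrite /= !big_cons big_nil asboolF // asboolT // addr0.
apply/copP; eexists; first by [].
by exists (fun c : bool => if c then a else b); [case|rewrite E].
Qed.

(** For [l = 0] the element [a] is arbitrary, so even the empty set has the zero singleton as its
    zero multiple, as the equation for the scalar [0] demands. *)
Lemma cscaleP X l (A : cset S X) phi :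
  cset_set (cscale l A) phi <->
  exists2 a, (l != 0 -> cset_set A a) & phi = fscale l a.
Proof.
have E (v : unit -> fsupp S X) :
    fbind (push [:: tt] (fun=> l) id) v = fscale l (v tt).
  apply: integ_eq => g; rewrite integ_fbind integ_push integ_fscale.
  by rewrite big_seq1.
have l_tt : push [:: tt] (fun=> l) id tt = l.
  by rewrite /= big_cons big_nil asboolT // addr0.
split=> [/copP[_ -> [v vP ->]]|[a Aa ->]].
  by exists (v tt) => [l0|]; [apply: (vP tt); rewrite l_tt|exact: E].
apply/copP; eexists; first by [].
by exists (fun=> a) => [[]|]; [rewrite l_tt|rewrite E].
Qed.

Lemma czeroP X phi : cset_set (czero X) phi <-> phi = fsupp0 S X.
Proof.
have E v : fbind (fsupp0 S void) v = fsupp0 S X.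
  by apply: integ_eq => g; rewrite integ_fbind !integ_fsupp0.
split=> [/copP[_ -> [v vP ->]]|->] //.
apply/copP; eexists; first by [].
by exists (fun=> fsupp0 S X) => [[]|]; rewrite E.
Qed.

Lemma csup_ub I X (A : I -> cset S X) i phi :
  cset_set (A i) phi -> cset_set (csup A) phi.
Proof.
move=> Aphi; apply/copP; exists (dirac S i); first exact: integ_dirac.
exists (fun=> phi); first by move=> j jN0; rewrite -(@dirac_neq0 S _ i j jN0).
by apply: integ_eq => g; rewrite integ_fbind integ_dirac.
Qed.

Lemma csup_lub I X (A : I -> cset S X) (B : cset S X) :
  (forall i, cset_set (A i) `<=` cset_set B) -> cset_set (csup A) `<=` cset_set B.
Proof.
move=> AB _ /copP[theta theta1 [v vA ->]]; apply: convex_fbind => // i /vA.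
exact: AB.
Qed.

(** [csup A] is itself the least upper bound under inclusion, so antisymmetry identifies it with
    [B]. The semilattice equations are checked through this universal property, without computing
    with weights. *)
Lemma csup_eq I X (A : I -> cset S X) (B : cset S X) :
  (forall i, cset_set (A i) `<=` cset_set B) ->
  (forall C, (forall i, cset_set (A i) `<=` cset_set C) ->
    cset_set B `<=` cset_set C) -> csup A = B.
Proof.
move=> AB BC; apply: cset_eq => phi; split; first exact: csup_lub.
by apply: BC => i psi; exact: csup_ub.
Qed.

Lemma cres_subproof X (B : set (fsupp S X)) (C : cset S X) :
  convex [set phi | forall psi, B psi -> cset_set C (fadd phi psi)].
Proof.
apply: fbind_convex => theta v theta1 vP psi Bpsi.
have -> : fadd (fbind theta v) psi = fbind theta (fun i => fadd (v i) psi).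
  apply: integ_eq => g; rewrite integ_fadd !integ_fbind.
  (* As [theta] has total weight one, [psi] is a combination of copies of itself. *)
  rewrite -[integ psi g](integ_cst1 _ theta1) -integD.
  by apply: integ_supp => i _; rewrite integ_fadd.
by apply: convex_fbind => // i /vP; exact.
Qed.

(* The residual of addition: the largest [D] with [D + B] inside [C]. *)
Definition cres X (B : set (fsupp S X)) (C : cset S X) : cset S X :=
  CSet (@cres_subproof X B C).

Lemma semifield_inv_neq0 (l : S) : l <> 0 ->
  exists2 m : S, m <> 0 & l * m = 1 /\ m * l = 1.
Proof.
move=> l0; have [m [lm ml]] := Sfield l0; exists m => // m0.
by apply: l0; rewrite -[l]mulr1 -lm m0 mulr0 mulr0.
Qed.

Lemma cscaleS X l (A B : cset S X) : cset_set A `<=` cset_set B ->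
  cset_set (cscale l A) `<=` cset_set (cscale l B).
Proof.
by move=> AB _ /cscaleP[a Aa ->]; apply/cscaleP; exists a => // /Aa/AB.
Qed.

Lemma csup_unit X (A : unit -> cset S X) : csup A = A tt.
Proof. by apply: csup_eq => [[]|C] //; exact. Qed.

Lemma csup_surj I J X (f : I -> J) (A : J -> cset S X) :
  (forall j, exists i, f i = j) -> csup A = csup (fun i => A (f i)).
Proof.
move=> fsurj; apply: csup_eq => [j|C AC].
  by have [i <-] := fsurj j => phi; exact: (@csup_ub I X (fun i => A (f i))).
by apply: csup_lub => i; exact: AC.
Qed.

Lemma csup_fibers I J X (f : I -> J) (A : I -> cset S X) :
  csup A = csup (fun j : J => csup (fun i : {i : I | f i = j} => A (sval i))).
Proof.
apply: csup_eq => [i phi Aphi|C AC].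
  apply: (csup_ub (i := f i)).
  exact: (@csup_ub _ X (fun k : {k | f k = f i} => A (sval k)) (exist _ i erefl)).
by apply: csup_lub => j; apply: csup_lub => -[i /= _]; exact: AC.
Qed.

Lemma caddA X (A B C : cset S X) : cadd A (cadd B C) = cadd (cadd A B) C.
Proof.
apply: cset_eq => phi; split.
  case/caddP => a Aa [_ /caddP[b Bb [c Cc ->]] ->]; apply/caddP.
  by exists (fadd a b); [apply/caddP; exists a => //; exists b|exists c; rewrite ?faddA].
case/caddP => _ /caddP[a Aa [b Bb ->]] [c Cc ->]; apply/caddP.
by exists a => //; exists (fadd b c); [apply/caddP; exists b => //; exists c|rewrite faddA].
Qed.

Lemma caddC X (A B : cset S X) : cadd A B = cadd B A.
Proof.
apply: cset_eq => phi; split=> /caddP[a Aa [b Bb ->]]; apply/caddP;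
  by exists b => //; exists a; rewrite // faddC.
Qed.

Lemma cadd0 X (A : cset S X) : cadd A (czero X) = A.
Proof.
apply: cset_eq => phi; split=> [/caddP[a Aa [_ /czeroP -> ->]]|Aphi].
  by rewrite fadd0.
apply/caddP; exists phi => //; exists (fsupp0 S X); last by rewrite fadd0.
exact/czeroP.
Qed.

Lemma cscale_zero X l : cscale l (czero X) = czero X.
Proof.
apply: cset_eq => phi; split=> [/cscaleP[a za ->]|/czeroP ->]; last first.
  by apply/cscaleP; exists (fsupp0 S X) => [_|]; [exact/czeroP|rewrite fscale_fsupp0].
apply/czeroP; have [->|/za/czeroP ->] := eqVneq l 0; first by rewrite fscale0.
exact: fscale_fsupp0.
Qed.

Lemma cscale0 X (A : cset S X) : cscale 0 A = czero X.
Proof.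
apply: cset_eq => phi; split=> [/cscaleP[a _ ->]|/czeroP ->].
  by apply/czeroP; rewrite fscale0.
by apply/cscaleP; exists (fsupp0 S X); rewrite ?eqxx ?fscale0.
Qed.

Lemma cscale1 X (A : cset S X) : cscale 1 A = A.
Proof.
apply: cset_eq => phi; split=> [/cscaleP[a Aa ->]|Aphi]; last first.
  by apply/cscaleP; exists phi; rewrite ?fscale1.
rewrite fscale1; have [S1|/Aa //] := eqVneq (1 : S) 0; exact: trivial_cset.
Qed.

Lemma cscaleM X l m (A : cset S X) : cscale (l * m) A = cscale l (cscale m A).
Proof.
apply: cset_eq => phi; split=> /cscaleP[a Aa ->]; apply/cscaleP.
  exists (fscale m a); last by rewrite fscaleA.
  move=> l0; apply/cscaleP; exists a => // m0; apply: Aa.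
  exact: semifield_mul_neq0.
have [l0|l0] := eqVneq l 0.
  by exists a; rewrite l0 mul0r ?eqxx // !fscale0.
have /cscaleP[b Ab ->] := Aa l0; exists b; last by rewrite fscaleA.
by move=> lm; apply: Ab; apply: contra_neq lm => ->; rewrite mulr0.
Qed.

Lemma cscaleDr X l (A B : cset S X) :
  cscale l (cadd A B) = cadd (cscale l A) (cscale l B).
Proof.
apply: cset_eq => phi; split.
  case/cscaleP=> c Ac ->; have [l0|l0] := eqVneq l 0.
    rewrite l0 !cscale0 cadd0 fscale0; exact/czeroP.
  have /caddP[a Aa [b Bb ->]] := Ac l0; rewrite fscaleDr; apply/caddP.
  exists (fscale l a); first by apply/cscaleP; exists a.
  by exists (fscale l b) => //; apply/cscaleP; exists b.
case/caddP => _ /cscaleP[a Aa ->] [_ /cscaleP[b Bb ->] ->].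
apply/cscaleP; exists (fadd a b); last by rewrite fscaleDr.
by move=> l0; apply/caddP; exists a; [exact: Aa|exists b => //; exact: Bb].
Qed.

(** Convexity gives the inclusion from right to left: for nonzero [l] and [m], positivity makes
    [l + m] invertible with an inverse [n], and the sum of the multiples of [a] and [b] is [l + m]
    times their average with weights [n * l] and [n * m]. *)
Lemma cscaleDl X l m (A : cset S X) :
  cscale (l + m) A = cadd (cscale l A) (cscale m A).
Proof.
have [->|l0] := eqVneq l 0; first by rewrite add0r cscale0 caddC cadd0.
have [->|m0] := eqVneq m 0; first by rewrite addr0 cscale0 cadd0.
have lm0 : l + m <> 0 by move=> /Spos[/eqP]; rewrite (negbTE l0).
apply: cset_eq => phi; split.
  case/cscaleP => a Aa ->; have {}Aa : cset_set A a by apply: Aa; exact/eqP.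
  by apply/caddP; exists (fscale l a); [|exists (fscale m a)];
    rewrite ?fscaleDl //; apply/cscaleP; exists a.
case/caddP => _ /cscaleP[a Aa ->] [_ /cscaleP[b Bb ->] ->].
have [n [nK Kn]] := Sfield lm0.
apply/cscaleP; exists (fadd (fscale (n * l) a) (fscale (n * m) b)); last first.
  by rewrite fscaleDr !fscaleA !mulrA nK !mul1r.
move=> lm; have -> : fadd (fscale (n * l) a) (fscale (n * m) b) =
    fbind (push [:: true; false] (fun c : bool => if c then n * l else n * m) id)
      (fun c : bool => if c then a else b).
  apply: integ_eq => g; rewrite integ_fbind integ_push integ_fadd !integ_fscale.
  by rewrite !big_cons big_nil addr0.
apply: convex_fbind => [|[] _]; [|exact: Aa|exact: Bb].
by rewrite integ_push !big_cons big_nil !mulr1 addr0 -mulrDr.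
Qed.

(** Scaling by [l] is monotone with a monotone inverse, scaling by [m], and an order isomorphism
    preserves least upper bounds. *)
Lemma cscale_sup I X l (A : I -> cset S X) : l <> 0 ->
  cscale l (csup A) = csup (fun i => cscale l (A i)).
Proof.
move=> l0; have [m m0 [lm ml]] := semifield_inv_neq0 l0.
apply/esym/csup_eq => [i|C AC].
  by apply: cscaleS => phi; exact: csup_ub.
rewrite -[C]cscale1 -lm cscaleM; apply: cscaleS; apply: csup_lub => i.
by rewrite -[A i]cscale1 -ml cscaleM; apply: cscaleS; exact: AC.
Qed.

(** By residuation, one argument at a time: a bound [C] of all pairwise sums is first extended from
    the [A i] to [csup A] with [B j] fixed, then from the [B j] to [csup B] with [csup A] fixed. *)
Lemma cadd_sup I J X (A : I -> cset S X) (B : J -> cset S X) :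
  cadd (csup A) (csup B) = csup (fun p : I * J => cadd (A p.1) (B p.2)).
Proof.
apply/esym/csup_eq => [[i j] _ /caddP[a Aa [b Bb ->]]|C AC].
  apply/caddP; exists a; first exact: (csup_ub (i := i)).
  by exists b => //; exact: (csup_ub (i := j)).
have AC' j : cset_set (csup A) `<=` cset_set (cres (cset_set (B j)) C).
  apply: csup_lub => i a Aa b Bb; apply: (AC (i, j)); apply/caddP.
  by exists a => //; exists b.
have BC : cset_set (csup B) `<=` cset_set (cres (cset_set (csup A)) C).
  by apply: csup_lub => j b Bb a Aa; rewrite faddC; exact: (AC' j a Aa b Bb).
by move=> _ /caddP[a Aa [b Bb ->]]; rewrite faddC; exact: (BC b Bb a Aa).
Qed.

End FreeAlgebra.

(** * From Eilenberg-Moore algebras to algebras of the theory *)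

Section MonadAlgebraToAlgebra.
Variables (S : pzSemiRingType) (Spos : positive_semiring S).
Hypothesis Sfield : semifield S.
Local Notation C := (convex_monad Spos Sfield).
Implicit Types (E : EM_obj C) (I : Sets).

Definition em_car E : Sets := em_obj E.

Definition eval E : cset S (em_car E) -> em_car E := em_str E.

Definition eop E I (t : cset S I) (x : I -> em_car E) : em_car E :=
  eval (cmap x t).

Lemma eval_ceta E (x : em_car E) : eval (ceta S x) = x.
Proof. exact: (congr1 (fun f : em_car E -> em_car E => f x) (em_unit E)). Qed.

(** This is the multiplication law of [E] at [cmap A t]; it makes [eval] commute with every
    operation. *)
Lemma eval_cop E I (t : cset S I) (A : I -> cset S (em_car E)) :
  eval (cop Spos Sfield t A) = eop t (fun i => eval (A i)).
Proof.
have /(congr1 (fun f => f (cmap A t))) /= := em_mult E.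
by rewrite /eop (cmapM (@eval E) A); apply.
Qed.

Definition esup E I (x : I -> em_car E) : em_car E := eop (cdist S I) x.
Definition eadd E (x y : em_car E) : em_car E :=
  eop (tadd S) (fun b => if b then x else y).
Definition ezero E : em_car E := eop (tzero S) (fun i : void => match i with end).
Definition escale E (l : S) (x : em_car E) : em_car E := eop (tscale l) (fun=> x).

Lemma eval_csup E I (A : I -> cset S (em_car E)) :
  eval (csup Spos Sfield A) = esup (fun i => eval (A i)).
Proof. exact: eval_cop. Qed.

Lemma eval_cadd E (A B : cset S (em_car E)) :
  eval (cadd Spos Sfield A B) = eadd (eval A) (eval B).
Proof.
by rewrite /cadd eval_cop /eadd; congr eop; apply/funext => -[].
Qed.

Lemma eval_czero E : eval (czero Spos Sfield (em_car E)) = ezero E.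
Proof. by rewrite /czero eval_cop /ezero; congr eop; apply/funext => -[]. Qed.

Lemma eval_cscale E l (A : cset S (em_car E)) :
  eval (cscale Spos Sfield l A) = escale l (eval A).
Proof. exact: eval_cop. Qed.

Definition evalE := (eval_csup, eval_cadd, eval_czero, eval_cscale).

Lemma ceta_funK E I (x : I -> em_car E) : x = fun i => eval (ceta S (x i)).
Proof. by apply/funext => i; rewrite eval_ceta. Qed.

(* [eval] is a surjective homomorphism from the free algebra on [E], with
   section [ceta]; the equations of the theory thus pass to [E]. *)
Definition em_alg E : alg S.
Proof.
refine (@Alg S (em_car E) (@esup E) (@eadd E) (ezero E) (@escale E)
  _ _ _ _ _ _ _ _ _ _ _ _ _ _).
- by move=> x; rewrite (ceta_funK x) -eval_csup csup_unit.
- move=> I J f x fsurj; rewrite (ceta_funK x) -!eval_csup.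
  by rewrite (csup_surj _ _ _ fsurj).
- move=> I J f x; rewrite (ceta_funK x) -eval_csup (csup_fibers _ _ f).
  by rewrite eval_csup; congr esup; apply/funext => j; rewrite eval_csup.
- move=> x y z; rewrite -[x]eval_ceta -[y]eval_ceta -[z]eval_ceta -!evalE.
  by rewrite caddA.
- by move=> x y; rewrite -[x]eval_ceta -[y]eval_ceta -!evalE caddC.
- by move=> x; rewrite -[x]eval_ceta -!evalE cadd0.
- by move=> l; rewrite -!evalE cscale_zero.
- by move=> x; rewrite -[x]eval_ceta -!evalE cscale0.
- by move=> x; rewrite -[x]eval_ceta -!evalE cscale1.
- by move=> l m x; rewrite -[x]eval_ceta -!evalE cscaleM.
- by move=> l x y; rewrite -[x]eval_ceta -[y]eval_ceta -!evalE cscaleDr.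
- by move=> l m x; rewrite -[x]eval_ceta -!evalE cscaleDl.
- move=> l I x l0; rewrite (ceta_funK x) -(eval_csup (fun i => ceta S (x i))).
  rewrite -eval_cscale cscale_sup // eval_csup.
    by congr esup; apply/funext => i; rewrite eval_cscale.
- move=> I J x y; rewrite (ceta_funK x) (ceta_funK y).
  rewrite -(eval_csup (fun i => ceta S (x i))) -(eval_csup (fun j => ceta S (y j))).
  rewrite -eval_cadd cadd_sup eval_csup.
  by congr esup; apply/funext => i; rewrite eval_cadd.
Defined.

Section Morphism.
Variables (E E' : EM_obj C) (f : EM_hom E E').
Let fE : em_car E -> em_car E' := em_hom f.

Lemma em_hom_eval (A : cset S (em_car E)) : fE (eval A) = eval (cmap fE A).
Proof. exact: (congr1 (fun g => g A) (em_homP f)). Qed.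

Lemma em_hom_eop I (t : cset S I) (x : I -> em_car E) :
  fE (eop t x) = eop t (fun i => fE (x i)).
Proof. by rewrite em_hom_eval -cmapM. Qed.

Definition em_alg_hom : alg_hom (em_alg E) (em_alg E').
Proof.
refine (@AlgHom S (em_alg E) (em_alg E') fE _ _ _ _).
- by move=> I x; exact: em_hom_eop.
- by move=> x y; rewrite /= em_hom_eop; congr eop; apply/funext => -[].
- by rewrite /= em_hom_eop; congr eop; apply/funext => -[].
- by move=> l x; exact: em_hom_eop.
Defined.

End Morphism.

Definition em_to_alg : functor (EM C) (AlgCat S).
Proof.
refine (@Functor (EM C) (AlgCat S) em_alg (fun E E' f => em_alg_hom f) _ _).
- by move=> E; exact: alg_hom_eq.
- by move=> E1 E2 E3 g f; exact: alg_hom_eq.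
Defined.

End MonadAlgebraToAlgebra.

(** * Semimodule structure and order of an algebra of the theory *)

Definition smod (S : pzSemiRingType) (X : alg S) := {classic alg_car X}.
HB.instance Definition _ (S : pzSemiRingType) (X : alg S) :=
  Choice.on (smod X).

Lemma aadd0l (S : pzSemiRingType) (X : alg S) (x : alg_car X) :
  aadd (azero X) x = x.
Proof. by rewrite aaddC aadd0. Qed.

HB.instance Definition _ (S : pzSemiRingType) (X : alg S) :=
  GRing.isNmodule.Build (smod X) (@aaddA S X) (@aaddC S X) (@aadd0l S X).
HB.instance Definition _ (S : pzSemiRingType) (X : alg S) :=
  GRing.Nmodule_isLSemiModule.Build S (smod X)
    (fun l m x => esym (ascaleM l m x)) (@ascale0 S X) (@ascale1 S X)
    (@ascaleDr S X) (fun x l m => ascaleDl l m x).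

Section AlgebraOrder.
Variables (S : pzSemiRingType) (X : alg S).
Implicit Types (I J : Sets) (x y z p : smod X).
Local Notation sup x := (asup X x : smod X).

Lemma asup_cst I (i0 : I) x : asup X (fun _ : I => x) = x.
Proof.
rewrite -(@asup_surj S X I unit (fun=> tt) (fun=> x)) ?asup_unit // => -[].
by exists i0.
Qed.

(** The fibre over [j] may be presented by any type [K j] that [g j] maps onto it, since surjective
    reindexing does not change a supremum. *)
Lemma asup_fib I J (f : I -> J) (K : J -> Sets) (g : forall j, K j -> I)
    (x : I -> smod X) :
  (forall j k, f (g j k) = j) -> (forall i, exists k, g (f i) k = i) ->
  asup X x = asup X (fun j => asup X (fun k : K j => x (g j k))).
Proof.
move=> fg gf; rewrite (asup_fibers f); congr asup; apply/funext => j.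
rewrite (asup_surj (f := fun k : K j => exist (fun i => f i = j) _ (fg j k))) //.
case=> i ij; have [k ki] := gf i; case: j / ij in k ki *; exists k.
exact: eq_exist.
Qed.

Definition ale x y : Prop := asup X (fun b : bool => if b then x else y) = y.

Lemma asup2C x y :
  asup X (fun b : bool => if b then x else y) =
  asup X (fun b : bool => if b then y else x).
Proof.
rewrite (asup_surj (f := negb)) => [|b]; last by exists (~~ b); rewrite negbK.
by congr asup; apply/funext => -[].
Qed.

Lemma asup_option I (x : I -> smod X) y :
  asup X (fun b : bool => if b then asup X x else y) =
  asup X (fun o : option I => if o is Some i then x i else y).
Proof.
rewrite [RHS](@asup_fib _ bool isSome
  (fun b => if b then I else unit)
  (fun b => if b is true then @Some I else fun=> None)); last 2 first.
- by case.
- by case=> [i|]; [exists i|exists tt].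
by congr asup; apply/funext => -[]; rewrite ?asup_unit.
Qed.

Lemma ale_refl x : ale x x.
Proof.
rewrite /ale -[RHS](@asup_cst bool true); congr asup; apply/funext.
by case.
Qed.

Lemma ale_anti x y : ale x y -> ale y x -> x = y.
Proof. by rewrite /ale asup2C => -> . Qed.

Lemma ale_sup I (x : I -> smod X) i : ale (x i) (asup X x).
Proof.
rewrite /ale asup2C asup_option.
(* Repeating the term [x i] at [None] is a surjective reindexing. *)
rewrite [RHS](asup_surj (f := fun o : option I => if o is Some j then j else i)).
  by congr asup; apply/funext => -[].
by move=> j; exists (Some j).
Qed.

Lemma ale_trans y x z : ale x y -> ale y z -> ale x z.
Proof.
rewrite {1}/ale => xy yz; move: (yz); rewrite /ale -{1}xy asup_option.
by move=> <-; exact: (ale_sup _ (Some true)).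
Qed.

Lemma asup_ale I (x : I -> smod X) z :
  (forall i, ale (x i) z) -> ale (asup X x) z.
Proof.
move=> xz; rewrite /ale asup_option.
pose y (o : option I) := if o is Some i then x i else z.
(* As [option I] is inhabited even for empty [I], [z] is the supremum of a constant family, each
   term of which is the join of [y o] and [z]. Flattened over pairs [(o, b)], this family is a
   surjective reindexing of [y], because [z] is the value of [y] at [None]. *)
rewrite -[RHS](asup_cst (None : option I) z).
have -> : (fun _ : option I => z) =
    fun o => asup X (fun b : bool => if b then y o else z).
  by apply/funext => -[i|] /=; [rewrite xz|rewrite ale_refl].
rewrite -(@asup_fib _ _ (fst : option I * bool -> _) (fun=> bool)
  (fun o b => (o, b)) (fun k => if k.2 then y k.1 else z)) //; last first.
  by case=> o b; exists b.
rewrite (asup_surj (f := fun k : option I * bool => if k.2 then k.1 else None)).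
  by congr asup; apply/funext => -[[i|] []].
by move=> o; exists (o, true).
Qed.

Lemma add_asup_ale I p (x : I -> smod X) z :
  (forall i, ale (p + x i) z) -> ale (p + sup x) z.
Proof.
move=> pxz; rewrite -[p in ale (p + _) _](asup_cst tt).
have -> : sup (fun _ : unit => p) + sup x = sup (fun k : unit * I => p + x k.2).
  exact: aadd_sup.
by apply: asup_ale => k; exact: pxz.
Qed.

(** With [y] written as the join of [x] and [y], distributivity exhibits [p + x] as one term of a
    supremum equal to [p + y]. *)
Lemma ale_add p x y : ale x y -> ale (p + x) (p + y).
Proof.
move=> xy; rewrite -[y in ale _ (_ + y)]xy -[p in ale _ (p + _)](asup_cst tt).
have -> : sup (fun _ : unit => p) + sup (fun b : bool => if b then x else y) =
  sup (fun k : unit * bool => p + if k.2 then x else y) by exact: aadd_sup.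
exact: (ale_sup (fun k : unit * bool => p + if k.2 then x else y) (tt, true)).
Qed.

Lemma ale_scale l x y : ale x y -> ale (l *: x) (l *: y).
Proof.
(* Distributivity is available for nonzero scalars; for zero both sides vanish. *)
have [-> _|/eqP l0 xy] := eqVneq l 0; first by rewrite !scale0r; exact: ale_refl.
rewrite -[y in ale _ (_ *: y)]xy.
have -> : l *: sup (fun b : bool => if b then x else y) =
  sup (fun b : bool => l *: if b then x else y) by exact: ascale_sup.
exact: (ale_sup (fun b : bool => l *: if b then x else y) true).
Qed.

Lemma ale_lincomb (T : Sets) (phi : fsupp S T) (g h : T -> smod X) :
  (forall t, phi t != 0 -> ale (g t) (h t)) ->
  ale (lincomb phi g) (lincomb phi h).
Proof.
move=> gh; rewrite /lincomb.
have : forall t : {classic T}, t \in suppseq phi -> ale (g t) (h t).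
  by move=> t; rewrite mem_suppseq; exact: gh.
elim: (suppseq phi : seq _) => [|t r IH] rP.
  by rewrite !big_nil; exact: ale_refl.
rewrite !big_cons; apply: (ale_trans (y := phi t *: g t + \sum_(j <- r) phi j *: h j)).
  by apply: ale_add; apply: IH => s sr; apply: rP; rewrite inE sr orbT.
rewrite ![_ + \sum_(j <- r) phi j *: h j]addrC; apply/ale_add/ale_scale.
by apply: rP; rewrite inE eqxx.
Qed.

Definition setsup (P : set (smod X)) : smod X :=
  asup X (fun p : {x | P x} => sval p).

Lemma ale_setsup (P : set (smod X)) x : P x -> ale x (setsup P).
Proof. by move=> Px; exact: (ale_sup _ (exist P x Px)). Qed.

Lemma setsup_ale (P : set (smod X)) z : (forall x, P x -> ale x z) -> ale (setsup P) z.
Proof. by move=> Pz; apply: asup_ale => -[x Px]; exact: Pz. Qed.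

(** Suprema are distributed out one summand at a time, while [p] accumulates the summands whose
    element is already chosen. Nonzero coefficients let scaling distribute over every supremum, even
    an empty one. *)
Lemma sum_setsup_ale (I : eqType) (r : seq I) (w : I -> S)
    (D : I -> set (smod X)) p z :
  uniq r -> (forall i, i \in r -> w i != 0) ->
  (forall u : I -> smod X, (forall i, i \in r -> D i (u i)) ->
    ale (p + \sum_(i <- r) w i *: u i) z) ->
  ale (p + \sum_(i <- r) w i *: setsup (D i)) z.
Proof.
elim: r p => [|i r IH] p /=.
  by move=> _ _ /(_ (fun=> 0)); rewrite !big_nil; apply.
case/andP=> ir ur wN0 uz; rewrite big_cons addrCA addrC.
set q := p + _.
have -> : w i *: setsup (D i) = sup (fun d : {x | D i x} => w i *: sval d).
  apply: ascale_sup; apply/eqP/wN0; exact: mem_head.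
apply: add_asup_ale => -[x Dx] /=; rewrite /q addrAC.
apply: IH => // [j jr|u uD]; first by apply: wN0; rewrite inE jr orbT.
pose u' j := if j == i then x else u j.
have u'i : u' i = x by rewrite /u' eqxx.
have := uz u'; rewrite big_cons u'i addrA => H.
rewrite (eq_big_seq (fun j => w j *: u' j)); last first.
  by move=> j jr; rewrite /u'; case: eqP => // ji; rewrite ji (negbTE ir) in jr.
apply: H => j; rewrite inE /u'; case: eqP => [-> //|_ /=]; exact: uD.
Qed.

Lemma lincomb_setsup_ale (T : Sets) (phi : fsupp S T) (D : T -> set (smod X)) z :
  (forall u : T -> smod X, (forall t, phi t != 0 -> D t (u t)) ->
    ale (lincomb phi u) z) ->
  ale (lincomb phi (fun t => setsup (D t))) z.
Proof.
move=> uz; rewrite -[lincomb _ _]add0r; apply: sum_setsup_ale => [||u uD].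
- exact: fset_uniq.
- by move=> t; rewrite mem_suppseq.
by rewrite add0r; apply: uz => t tN0; apply: uD; rewrite mem_suppseq.
Qed.

End AlgebraOrder.

(** * From algebras of the theory to Eilenberg-Moore algebras *)

Section AlgebraToMonadAlgebra.
Variables (S : pzSemiRingType) (Spos : positive_semiring S).
Hypothesis Sfield : semifield S.
Local Notation C := (convex_monad Spos Sfield).

Definition fval (X : alg S) (phi : fsupp S (alg_car X)) : smod X :=
  lincomb phi (id : alg_car X -> smod X).

Definition cval (X : alg S) (A : cset S (alg_car X)) : smod X :=
  setsup (@fval X @` cset_set A).

Lemma fval_fsmap_cval (X : alg S) (Om : fsupp S (cset S (alg_car X))) :
  fval (fsmap (@cval X) Om) = lincomb Om (@cval X).
Proof. exact: lincomb_fsmap. Qed.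

Lemma fval_fbind (X : alg S) (I : Sets) (theta : fsupp S I)
    (v : I -> fsupp S (alg_car X)) :
  fval (fbind theta v) = lincomb theta (fun i => fval (v i)).
Proof. by rewrite /fval lincomb_fsmu lincomb_fsmap. Qed.

Lemma cval_csingle (X : alg S) (phi : fsupp S (alg_car X)) :
  cval (csingle phi) = fval phi.
Proof.
apply: ale_anti; last by apply: ale_setsup; exists phi.
by apply: setsup_ale => _ [_ -> <-]; exact: ale_refl.
Qed.

Lemma cval_ceta (X : alg S) (x : alg_car X) : cval (ceta S x) = x.
Proof.
have -> : ceta S x = csingle (dirac S x) by exact: cset_eq.
by rewrite cval_csingle /fval lincomb_dirac.
Qed.

Lemma cval_cmu (X : alg S) (AA : cset S (cset S (alg_car X))) :
  cval (cmu Spos Sfield AA) = cval (cmap (@cval X) AA).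
Proof.
apply: ale_anti; apply: setsup_ale => x [].
  move=> _ /cmu_setP[Om AOm [u uP ->]] <-; rewrite fval_fbind.
  apply: (ale_trans (y := lincomb Om (@cval X))).
    by apply: ale_lincomb => A /uP Au; apply: ale_setsup; exists (u A).
  rewrite -fval_fsmap_cval; apply: ale_setsup; exists (fsmap (@cval X) Om) => //.
  by exists Om.
move=> _ [Om AOm <-] <-; rewrite fval_fsmap_cval.
(* Distributivity reduces the bound to arbitrary choices [u A] of values; lifting these to elements
   [v A] of the sets [A] gives an element of the multiplication with the same value. *)
apply: lincomb_setsup_ale => u uP.
have [|v vP] := @supp_choice S _ Om (fsupp S (alg_car X)) (fsupp0 S _)
  (fun A psi => cset_set A psi /\ fval psi = u A).
  by move=> A /uP[psi Apsi E]; exists psi.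
rewrite (@lincomb_supp _ _ _ _ _ (fun A => fval (v A))) => [|A /vP[]//].
rewrite -fval_fbind; apply: ale_setsup; exists (fbind Om v) => //.
by apply/cmu_setP; exists Om => //; exists v => // A /vP[].
Qed.

Definition alg_em (X : alg S) : EM_obj C.
Proof.
refine (@EMObj SetCat C (alg_car X) (@cval X) _ _).
- by apply/funext => x; exact: cval_ceta.
- by apply/funext => AA; exact: cval_cmu.
Defined.

Section Morphism.
Variables (X Y : alg S) (f : alg_hom X Y).

Lemma alg_fun_lincomb (T : Sets) (phi : fsupp S T) (g : T -> smod X) :
  f (lincomb phi g) = lincomb phi (fun t => f (g t) : smod Y).
Proof.
rewrite /lincomb; elim: (suppseq phi : seq _) => [|t r IH].
  by rewrite !big_nil; exact: alg_fun_zero.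
rewrite !big_cons -IH.
by rewrite [LHS]alg_fun_add alg_fun_scale.
Qed.

(** Both sides are suprema of the same elements [f (fval phi)], but over different index sets, so
    they are compared in the order. *)
Lemma alg_fun_cval (A : cset S (alg_car X)) : f (cval A) = cval (cmap f A).
Proof.
have fE phi : f (fval phi) = fval (fsmap f phi).
  by rewrite /fval alg_fun_lincomb lincomb_fsmap.
rewrite /cval /setsup alg_fun_sup; apply: ale_anti.
  apply: asup_ale => -[x Ax] /=; case: Ax => phi Aphi <-; rewrite fE.
  apply: ale_setsup.
  by exists (fsmap f phi) => //; exists phi.
apply: setsup_ale => _ [_ [phi Aphi <-] <-]; rewrite -fE.
have Aval : (@fval X @` cset_set A) (fval phi) by exists phi.
exact: (ale_sup (fun p : {x | (@fval X @` cset_set A) x} => f (sval p))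
  (exist _ _ Aval)).
Qed.

Definition alg_em_hom : EM_hom (alg_em X) (alg_em Y).
Proof.
refine (@EMHom SetCat C (alg_em X) (alg_em Y) f _).
by apply/funext => A; exact: alg_fun_cval.
Defined.

End Morphism.

Definition alg_to_em : functor (AlgCat S) (EM C).
Proof.
refine (@Functor (AlgCat S) (EM C) alg_em (fun X Y f => alg_em_hom f) _ _).
- by move=> X; exact: EM_hom_eq.
- by move=> X Y Z g f; exact: EM_hom_eq.
Defined.

(** * The two passages are mutually inverse *)

(** By induction along the support, a singleton is a sum of scaled Dirac singletons in the free
    algebra, and [eval] preserves sums and multiples. *)
Lemma eval_csingle (E : EM_obj C) (phi : fsupp S (em_car E)) :
  eval (csingle phi) = fval (phi : fsupp S (alg_car (em_alg E))).
Proof.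
rewrite -[in LHS](push_fsupp phi) /fval /lincomb.
elim: (suppseq phi : seq _) => [|x r IH].
  rewrite big_nil; have <- : czero Spos Sfield (em_car E) = csingle (push [::] phi id).
    by apply: cset_eq => psi; rewrite czeroP; split=> ->;
      apply: integ_eq => g; rewrite integ_fsupp0 (@integ_push _ {classic em_car E}) big_nil.
  exact: eval_czero.
rewrite big_cons -IH.
have -> : csingle (push (x :: r) phi id) =
    cadd Spos Sfield (cscale Spos Sfield (phi x) (ceta S x))
      (csingle (push r phi id)).
  have E1 : push (x :: r) phi id =
      fadd (fscale (phi x) (dirac S x)) (push r phi id).
    apply: integ_eq => g; rewrite integ_fadd integ_fscale integ_dirac.
    by rewrite !(@integ_push _ {classic em_car E}) big_cons.
  apply: cset_eq => psi; rewrite E1; split=> [->|].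
    apply/caddP; eexists; last by eexists.
    by apply/cscaleP; eexists => [_|].
  case/caddP => _ /cscaleP[a aP ->] [_ -> ->].
  have [x0|xN0] := eqVneq (phi x) 0; first by rewrite x0 !fscale0.
  by rewrite (aP xN0).
by rewrite eval_cadd eval_cscale eval_ceta.
Qed.

Lemma csup_csingle (X : Sets) (A : cset S X) :
  csup Spos Sfield (fun p : {phi | cset_set A phi} => csingle (sval p)) = A.
Proof.
apply: csup_eq => [[phi Aphi] _ -> //|B BP phi Aphi].
exact: (BP (exist _ phi Aphi)).
Qed.

Lemma cval_eval (E : EM_obj C) (A : cset S (em_car E)) :
  @cval (em_alg E) A = eval A.
Proof.
rewrite -[in RHS](csup_csingle A) eval_csup.
apply: (@ale_anti _ (em_alg E)).
  apply: setsup_ale => _ [phi Aphi <-]; rewrite -eval_csingle.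
  exact: (@ale_sup _ (em_alg E) _
    (fun p : {phi | cset_set A phi} => eval (csingle (sval p))) (exist _ phi Aphi)).
apply: (@asup_ale _ (em_alg E)) => -[phi Aphi] /=; rewrite eval_csingle.
by apply: ale_setsup; exists phi.
Qed.

Lemma em_algK (E : EM_obj C) : alg_em (em_alg E) = E.
Proof.
case: E => E a p q; apply: EM_obj_eq; apply/funext => A.
exact: (@cval_eval (EMObj p q)).
Qed.

Lemma cval_csup (X : alg S) (I : Sets) (x : I -> alg_car X) :
  cval (csup Spos Sfield (fun i => ceta S (x i))) = asup X x.
Proof.
apply: ale_anti.
  apply: setsup_ale => _ [_ /copP[theta theta1 [v vP ->]] <-]; rewrite fval_fbind.
  (* The weights total one, so the supremum is a combination of copies of itself and bounds every
     convex combination of the [x i] termwise. *)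
  have -> : asup X x = lincomb theta (fun=> asup X x : smod X).
    rewrite /lincomb -scaler_suml.
    have -> : \sum_(i <- suppseq theta) theta i = 1.
      by rewrite -[RHS]theta1; apply: eq_bigr => i _; rewrite mulr1.
    by rewrite scale1r.
  apply: ale_lincomb => i /vP ->; rewrite /fval lincomb_dirac; exact: ale_sup.
apply: asup_ale => i; apply: ale_setsup; exists (dirac S (x i)).
  exact: (@csup_ub _ Spos Sfield I _ (fun j => ceta S (x j)) i).
exact: lincomb_dirac.
Qed.

Lemma eop_cval (X : alg S) (I : Sets) (t : cset S I) (x : I -> alg_car X) :
  @eop _ Spos Sfield (alg_em X) _ t x =
  cval (cop Spos Sfield t (fun i => ceta S (x i))).
Proof.
rewrite [RHS](@eval_cop _ _ _ (alg_em X)); congr eop; apply/funext => i.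
by rewrite [RHS]cval_ceta.
Qed.

(** The round trip keeps the carrier, so equality of algebras amounts to the identity being a
    homomorphism. Each operation is computed as the value of its term with Dirac singletons
    substituted. *)
Definition em_alg_counit (X : alg S) : alg_hom (em_alg (alg_em X)) X.
Proof.
refine (@AlgHom S (em_alg (alg_em X)) X id _ _ _ _).
- by move=> I x; rewrite [LHS]eop_cval; exact: cval_csup.
- move=> x y; rewrite [LHS]eop_cval.
  have -> : cop Spos Sfield (tadd S) (fun b => ceta S (if b then x else y)) =
      csingle (fadd (dirac S x) (dirac S y)).
    rewrite (_ : cop _ _ _ _ = cadd Spos Sfield (ceta S x) (ceta S y)).
      apply: cset_eq => phi; rewrite caddP; split=> [[_ -> [_ -> ->]] //|->].
      by exists (dirac S x) => //; exists (dirac S y).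
    by congr cop; apply/funext => -[].
  by rewrite cval_csingle /fval lincomb_fadd !lincomb_dirac.
- rewrite [LHS]eop_cval.
  rewrite (_ : cop _ _ _ _ = czero Spos Sfield (alg_car X)).
    rewrite (_ : czero _ _ _ = csingle (fsupp0 S _)).
      by rewrite cval_csingle /fval lincomb_fsupp0.
    by apply: cset_eq => phi; exact: czeroP.
  by congr cop; apply/funext => -[].
- move=> l x; rewrite [LHS]eop_cval.
  rewrite (_ : cop _ _ _ _ = csingle (fscale l (dirac S x))).
    by rewrite cval_csingle /fval lincomb_fscale lincomb_dirac.
  apply: cset_eq => phi; rewrite cscaleP; split=> [[a aP ->]|->].
    have [->|/aP -> //] := eqVneq l 0; by rewrite !fscale0.
  by exists (dirac S x).
Defined.

Lemma alg_emK (X : alg S) : em_alg (alg_em X) = X.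
Proof.
exact: (@alg_eq S (em_alg (alg_em X)) X erefl (em_alg_counit X) (fun=> erefl)).
Qed.

End AlgebraToMonadAlgebra.

Theorem theorem5p5 (S : pzSemiRingType) (Spos : positive_semiring S)
    (Sfield : semifield S) :
  isomorphic_over (EM_forget (convex_monad Spos Sfield)) (alg_forget S).
Proof.
exists (em_to_alg Spos Sfield), (alg_to_em Spos Sfield); split; [split|].
(* Both passages keep carriers and underlying functions, so the composites commute with the
   forgetful functors; as these are faithful, only the equality of objects remains. *)
- apply: (@functor_id_eq _ _ (EM_forget _)).
  + by move=> E E' f g; exact: EM_hom_eq.
  + exact: em_algK.
  + exact: functor_eq_hom.
- apply: (@functor_id_eq _ _ (alg_forget S)).
  + by move=> X Y f g; exact: alg_hom_eq.
  + exact: alg_emK.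
  + exact: functor_eq_hom.
- exact: functor_eq_hom.
Qed.
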